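(* Assume that $B$ is a basis of $L$. If $m(s)\notin P_{\mathcal N}$, then $v$ is an exponent of $H_A(\beta)$ with respect to $w$.
   Context: $\mathbb N=\{0,1,2,\dots\}$. $A=(a_{ij})$ is a $d\times n$ integer matrix of rank $d$ which is homogeneous: all its columns lie on one hyperplane of $\mathbb Q^d$ not passing through the origin. $L=\{u\in\mathbb Z^n: Au=0\}$. Each $u\in\mathbb Z^n$ is written uniquely as $u=u_+-u_-$ with $u_\pm\in\mathbb N^n$ of disjoint supports. $I_A=\langle\partial^u-\partial^{u'}: u,u'\in\mathbb N^n, Au=Au'\rangle\subset\mathbb C[\partial_1,\dots,\partial_n]$. For $\beta\in\mathbb C^d$, $H_A(\beta)$ is the left ideal of the Weyl algebra $\mathbb C\langle x,\partial\rangle$ generated by $I_A$ and $\sum_j a_{ij}\theta_j-\beta_i$ ($i=1,\dots,d$), $\theta_j=x_j\partial_j$. For $v\in\mathbb C^n$, $u\in\mathbb N^n$: $[v]_u=\prod_j v_j(v_j-1)\cdots(v_j-u_j+1)$; $\mathrm{nsupp}(v)=\{j: v_j\in\mathbb Z_{<0}\}$. Fix a generic weight $w\in\mathbb R^n$ (generic with respect to $I_A$ and $H_A(\beta)$; in particular $\mathrm{in}_w(I_A)$ is monomial) and a fake exponent $v$ of $H_A(\beta)$ with respect to $w$: $Av=\beta$ and $[v]_{u_+}=0$ for all $u\in L$ with $u_+\cdot w>u_-\cdot w$. $v$ is an exponent if it is a zero of the indicial ideal $\mathrm{ind}_w(H_A(\beta))=\bigl(\mathbb C(x)\langle\partial\rangle\cdot\mathrm{in}_{(-w,w)}(H_A(\beta))\bigr)\cap\mathbb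 C[\theta_1,\dots,\theta_n]$ (equivalently, there is a series solution of $H_A(\beta)$ in the direction of $w$ with starting term $x^vp(\log x)$, $p\neq0$ a polynomial). Write $I_u=\mathrm{nsupp}(v+u)$ for $u\in L$. $B=\{b^{(1)},\dots,b^{(h)}\}\subset L$ is also regarded as the $n\times h$ matrix with these columns; $\mathrm{supp}(B)$ is the set of indices of its nonzero rows. $s=(s_1,\dots,s_h)^T$ are indeterminates, $(Bs)_j=\sum_k b_j^{(k)}s_k$, $(Bs)^J=\prod_{j\in J}(Bs)_j$. Let $\{\partial^{g_+^{(i)}}-\partial^{g_-^{(i)}}: i=1,\dots,M\}$ be the reduced Gröbner basis of $I_A$ with respect to $w$, $\partial^{g_+^{(i)}}\in\mathrm{in}_w(I_A)$; $C(w)=\sum_i\mathbb Ng^{(i)}$. Put $\mathrm{NS}_w(v)=\{I_u: u\in L,\text{ and every }u'\in L\text{ with }I_{u'}=I_u\text{ lies in }C(w)\}$, $\mathcal N=\{I\in\mathrm{NS}_w(v):\mathrm{supp}(B)\cup I=\mathrm{supp}(B)\cup I_0\}$, $\mathcal N^c=\{I_u:u\in L,\mathrm{supp}(B)\cup I_u=\mathrm{supp}(B)\cup I_0\}\setminus\mathcal N$, $K_{\mathcal N}=\bigcap_{I\in\mathcal N}I$, $m(s)=(Bs)^{I_0\setminus K_{\mathcal N}}$, and $P_{\mathcal N}=\langle(Bs)^{(I\cup J)\setminus K_{\mathcal N}}:I\in\mathcal N,J\in\mathcal N^c\rangle\subset\mathbb C[s]$. *)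

(* Defs.v *)
From HB Require Import structures.
From mathcomp Require Import all_boot all_order all_algebra fraction ring.
From mathcomp Require Import boolp reals.
From mathcomp Require Import complex ssrcomplements mpoly.

Set Implicit Arguments.
Unset Strict Implicit.
Unset Printing Implicit Defensive.

Import GRing.Theory Num.Theory.
Local Open Scope ring_scope.

(* [diffop K] is the ring of differential operators with coefficients in a
  commutative ring [K] carrying commuting derivations d_1, ..., d_n.  Operators
  are kept in normal form  \sum_b f_b D^b  (coefficients on the left), i.e. they
  are stored as elements of [{mpoly K[n]}], the variables standing for
  D_1, ..., D_n; only the product differs from that of [{mpoly K[n]}]. *)

Record diffRing (n : nat) := DiffRing {
  diffRing_sort :> comNzRingType;
  der : 'I_n -> {additive diffRing_sort -> diffRing_sort};
  derM : forall i a b, der i (a * b) = der i a * b + a * der i b;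
  derC : forall i j a, der i (der j a) = der j (der i a)
}.

Arguments der {n} d i.

(* D_i o (f D^b) = f D^(b + e_i) + d_i(f) D^b *)
HB.lock Definition lmulD (n : nat) (K : diffRing n) (i : 'I_n)
  (Q : {mpoly K[n]}) : {mpoly K[n]} := 'X_i * Q + map_mpoly (der K i) Q.

Section DiffOp.
Variables (n : nat) (K : diffRing n).
Local Notation lmulD := (@lmulD.body n K).

Definition diffop : Type := {mpoly K[n]}.

HB.instance Definition _ := GRing.Zmodule.on diffop.

Implicit Types (P Q S : {mpoly K[n]}) (i j : 'I_n) (a b : 'X_{1..n}).

Definition lmulDm a Q : {mpoly K[n]} :=
  foldr (fun i => iter (a i) (lmulD i)) Q (enum 'I_n).

Definition diffop_mul P Q : {mpoly K[n]} :=
  \sum_(a <- msupp P) P@_a *: lmulDm a Q.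

Lemma lmulDB i : zmod_morphism (lmulD i).
Proof. by move=> P Q; rewrite lmulD.unlock mulrBr raddfB opprD addrACA. Qed.

HB.instance Definition _ i := GRing.isZmodMorphism.Build
  {mpoly K[n]} {mpoly K[n]} (lmulD i) (lmulDB i).

Lemma lmulDD i : {morph lmulD i : P Q / P + Q}.
Proof. exact: raddfD. Qed.

Lemma lmulDmB a : zmod_morphism (lmulDm a).
Proof.
move=> P Q; rewrite /lmulDm; elim: (enum _) => //= i s ->.
by elim: (a i) => //= k ->; rewrite raddfB.
Qed.

HB.instance Definition _ a := GRing.isZmodMorphism.Build
  {mpoly K[n]} {mpoly K[n]} (lmulDm a) (lmulDmB a).

Lemma der1 i : der K i 1 = 0.
Proof.
have := derM (d := K) i 1 1; rewrite !mulr1 mul1r => /eqP.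
by rewrite -subr_eq0 opprD addrA subrr sub0r oppr_eq0 => /eqP.
Qed.

Lemma lmulDZ i (f : K) Q :
  lmulD i (f *: Q) = der K i f *: Q + f *: lmulD i Q.
Proof.
have eQ : map_mpoly (der K i) (f *: Q) =
    der K i f *: Q + f *: map_mpoly (der K i) Q.
  apply/mpolyP=> k.
  by rewrite mcoeffD !mcoeffZ !mcoeff_map_mpoly mcoeffZ derM.
by rewrite lmulD.unlock eQ -scalerAr scalerDr addrCA.
Qed.

Lemma lmulDX i a : lmulD i 'X_[a] = 'X_[a + U_(i)].
Proof.
rewrite lmulD.unlock -mpolyXD addmC; apply/mpolyP=> k.
rewrite mcoeffD mcoeff_map_mpoly [in der K i _]mcoeffX.
by case: eqP => _; rewrite ?der1 ?raddf0 addr0.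
Qed.

Lemma lmulDDZX i j (f : K) a : lmulD i (lmulD j (f *: 'X_[a])) =
  der K i (der K j f) *: 'X_[a] + der K j f *: 'X_[a + U_(i)] +
  (der K i f *: 'X_[a + U_(j)] + f *: 'X_[a + U_(j) + U_(i)]).
Proof.
have -> : lmulD j (f *: 'X_[a]) = der K j f *: 'X_[a] + f *: 'X_[a + U_(j)].
  by rewrite lmulDZ lmulDX.
by rewrite [LHS]lmulDD; congr (_ + _); rewrite [LHS]lmulDZ lmulDX.
Qed.

Lemma lmulDC i j Q : lmulD i (lmulD j Q) = lmulD j (lmulD i Q).
Proof.
elim/mpolyind: Q => [|f m Q _ _ IH]; first by rewrite !raddf0.
have split k l P S :
    lmulD k (lmulD l (P + S)) = lmulD k (lmulD l P) + lmulD k (lmulD l S).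
  exact: etrans (congr1 (lmulD k) (lmulDD l P S)) (lmulDD k _ _).
rewrite [LHS]split [RHS]split; congr (_ + _); last exact: IH.
rewrite [LHS]lmulDDZX [RHS]lmulDDZX (derC j i) -!addrA; congr (_ + _).
by rewrite addrCA -!addmA [(U_(j) + _)%MM]addmC.
Qed.

Lemma lmulDmDU a i Q : lmulDm (a + U_(i)) Q = lmulD i (lmulDm a Q).
Proof.
rewrite /lmulDm.
have iterC j k P : lmulD i (iter k (lmulD j) P) = iter k (lmulD j) (lmulD i P).
  elim: k => // k IHk.
  exact: etrans (lmulDC _ _ _) (congr1 (lmulD j) IHk).
have := mem_enum 'I_n i; rewrite inE; move: (enum_uniq 'I_n).
elim: (enum 'I_n) => //= j s IH /andP[js us]; rewrite inE => /orP[/eqP eij|si].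
  subst j; rewrite mnmDE mnm1E eqxx addn1 iterS; congr (lmulD i (iter _ _ _)).
  elim: s js {IH us} => //= j s IH; rewrite inE negb_or => /andP[nij /IH ->].
  by rewrite mnmDE mnm1E (negPf nij) addn0.
rewrite (IH us si) mnmDE mnm1E iterC.
have -> : (i == j) = false; last by rewrite addn0.
by apply/eqP=> eij; rewrite -eij si in js.
Qed.

Lemma lmulDm0 Q : lmulDm 0%MM Q = Q.
Proof. by rewrite /lmulDm; elim: (enum _) => //= i s ->; rewrite mnm0E. Qed.

Lemma mnm_ind (T : 'X_{1..n} -> Prop) :
  T 0%MM -> (forall a i, T a -> T (a + U_(i))%MM) -> forall a, T a.
Proof.
move=> T0 TS a; have [k] := ubnP (mdeg a); elim: k a => // k IH a.
have [->//|/eqP a0] := a =P 0%MM; rewrite ltnS => ak.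
have [i ai] : exists i, (0 < a i)%N.
  apply/existsP; apply: contraR a0; rewrite negb_exists => /forallP a0.
  by apply/eqP/mnmP => i; rewrite mnm0E; move: (a0 i); case: (a i).
have eqa : a = ((a - U_(i)) + U_(i))%MM by rewrite submK // lep1mP -lt0n.
rewrite eqa; apply: TS; apply: IH; apply: leq_trans ak.
by rewrite [in leqRHS]eqa mdegD mdeg1 addn1.
Qed.

Lemma lmulDm1 a : lmulDm a 1 = 'X_[a].
Proof.
elim/mnm_ind: a => [|a i IH]; first by rewrite lmulDm0 mpolyX0.
by rewrite lmulDmDU IH lmulDX.
Qed.

Lemma diffop_mulE k P Q : (msize P <= k)%N ->
  diffop_mul P Q = \sum_(a : 'X_{1..n < k}) P@_a *: lmulDm a Q.
Proof.
move=> le_Pk; set I : subFinType _ := 'X_{1..n < k}.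
rewrite /diffop_mul (big_mksub I) ?msupp_uniq //=; first last.
  by move=> x /msize_mdeg_lt /leq_trans; apply.
rewrite big_rmcond //= => j /memN_msupp_eq0 ->.
by rewrite scale0r.
Qed.

Lemma diffop_mulDl : left_distributive diffop_mul +%R.
Proof.
move=> P P' Q; set k := maxn (msize (P + P')) (maxn (msize P) (msize P')).
rewrite !(@diffop_mulE k) ?leq_max ?leqnn ?orbT // -big_split /=.
by apply: eq_bigr => a _; rewrite mcoeffD scalerDl.
Qed.

Lemma diffop_mulDr : right_distributive diffop_mul +%R.
Proof.
move=> P Q Q'; rewrite /diffop_mul -big_split /=.
by apply: eq_bigr => a _; rewrite raddfD scalerDr.
Qed.

Lemma diffop_mulZX (f : K) a Q : diffop_mul (f *: 'X_[a]) Q = f *: lmulDm a Q.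
Proof.
have [->|f0] := eqVneq f 0.
  by rewrite !scale0r /diffop_mul msupp0 big_nil.
rewrite /diffop_mul msuppMCX // big_seq1 mcoeffZ mcoeffX eqxx.
by rewrite mulr1.
Qed.

Lemma diffop_mul0l Q : diffop_mul 0 Q = 0.
Proof. by rewrite /diffop_mul msupp0 big_nil. Qed.

Lemma diffop_mulZl (f : K) P Q : diffop_mul (f *: P) Q = f *: diffop_mul P Q.
Proof.
elim/mpolyind: P => [|g a P _ _ IH].
  by rewrite scaler0 diffop_mul0l scaler0.
by rewrite scalerDr !diffop_mulDl IH scalerDr scalerA !diffop_mulZX scalerA.
Qed.

Lemma diffop_mul_lmulD i P Q :
  diffop_mul (lmulD i P) Q = lmulD i (diffop_mul P Q).
Proof.
elim/mpolyind: P => [|g a P _ _ IH].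
  by rewrite raddf0 diffop_mul0l raddf0.
rewrite (lmulDD i (g *: _) P) (diffop_mulDl _ (lmulD i P)) (diffop_mulDl _ P).
rewrite (lmulDD i (diffop_mul (g *: _) Q)).
rewrite IH lmulDZ lmulDX diffop_mulDl.
by rewrite !diffop_mulZX lmulDZ lmulDmDU.
Qed.

Lemma diffop_mul_lmulDm a P Q :
  diffop_mul (lmulDm a P) Q = lmulDm a (diffop_mul P Q).
Proof.
elim/mnm_ind: a => [|a i IH]; first by rewrite !lmulDm0.
by rewrite !lmulDmDU diffop_mul_lmulD IH.
Qed.

Lemma diffop_mulA : associative diffop_mul.
Proof.
move=> P Q S; elim/mpolyind: P => [|g a P _ _ IH].
  by rewrite !diffop_mul0l.
by rewrite !diffop_mulDl IH !diffop_mulZX diffop_mulZl diffop_mul_lmulDm.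
Qed.

Lemma diffop_mul1l : left_id 1 diffop_mul.
Proof.
move=> Q; rewrite -mpolyX0 -[X in diffop_mul X]scale1r.
by rewrite diffop_mulZX lmulDm0 scale1r.
Qed.

Lemma diffop_mul1r : right_id 1 diffop_mul.
Proof.
move=> P; rewrite [RHS]mpolyE /diffop_mul.
by apply: eq_bigr => a _; rewrite lmulDm1.
Qed.

HB.instance Definition _ := GRing.Zmodule_isNzRing.Build diffop
  diffop_mulA diffop_mul1l diffop_mul1r diffop_mulDl diffop_mulDr
  (oner_neq0 {mpoly K[n]}).

Definition coef_op (f : K) : diffop := f%:MP.

Definition partial i : diffop := 'X_i.

Lemma coef_op_mul (f : K) P : coef_op f * (P : diffop) = f *: P.
Proof. by rewrite /coef_op -alg_mpolyC -mpolyX0 [LHS]diffop_mulZX lmulDm0. Qed.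

Lemma partial_mul i P : partial i * (P : diffop) = lmulD i P.
Proof.
rewrite /partial -[X in X * _]scale1r [LHS]diffop_mulZX scale1r.
by rewrite -[U_(i)%MM]add0m lmulDmDU lmulDm0.
Qed.

Lemma partial_coef i (f : K) :
  partial i * coef_op f = coef_op f * partial i + coef_op (der K i f).
Proof.
rewrite partial_mul coef_op_mul lmulD.unlock /coef_op map_mpolyC.
by rewrite -mul_mpolyC mulrC.
Qed.

End DiffOp.

Section QuotientRules.
Variable F : fieldType.
Implicit Types p q a b : F.

Lemma quot_subE p q p' q' : q != 0 -> q' != 0 ->
  p / q - p' / q' = (p * q' - p' * q) / (q * q').
Proof. by move=> *; field; apply/andP. Qed.
Lemma quot_derB p q p' q' a b a' b' : q != 0 -> q' != 0 ->
  (((a * q' + p * b') - (a' * q + p' * b)) * (q * q') - (p * q' - p' * q) * (b * q' + q * b')) / (q * q' * (q * q')) =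
  (a * q - p * b) / (q * q) - (a' * q' - p' * b') / (q' * q').
Proof. by move=> *; field; apply/andP. Qed.
Lemma quot_derM p q p' q' a b a' b' : q != 0 -> q' != 0 ->
  ((a * p' + p * a') * (q * q') - (p * p') * (b * q' + q * b')) / (q * q' * (q * q')) =
  (a * q - p * b) / (q * q) * (p' / q') + p / q * ((a' * q' - p' * b') / (q' * q')).
Proof. by move=> *; field; apply/andP. Qed.

End QuotientRules.

Section FracDer.
Variables (R : idomainType) (d : {additive R -> R}).
Hypothesis dM : forall a b, d (a * b) = d a * b + a * d b.

Local Notation "x %:F" := (@FracField.tofrac R x).

Definition fracder (f : {fraction R}) : {fraction R} :=
  let p := \n_(repr f) in let q := \d_(repr f) in
  (d p * q - p * d q)%:F / (q ^+ 2)%:F.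

Lemma frac_repr f : f = (\n_(repr f))%:F / (\d_(repr f))%:F.
Proof.
set x := repr f; have q0 : (\d_x)%:F != 0 by rewrite tofrac_eq0 denom_ratioP.
apply: (canRL (mulfK q0)); rewrite -[f in LHS]reprK -/x.
unlock FracField.tofrac; rewrite -[LHS]FracField.pi_mul /=.
apply/eqP; rewrite FracField.equivf_def /FracField.mulf.
by rewrite !numden_Ratio ?oner_neq0 ?mulr1 ?denom_ratioP // mulrC.
Qed.

Lemma fracP f : exists p q, q != 0 /\ f = p%:F / q%:F.
Proof. by exists \n_(repr f), \d_(repr f); split; [exact: denom_ratioP | exact: frac_repr]. Qed.

Lemma eq_frac p q p' q' : q != 0 -> q' != 0 ->
  (p%:F / q%:F == p'%:F / q'%:F) = (p * q' == p' * q).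
Proof. by move=> q0 q'0; rewrite eqr_div ?tofrac_eq0 // -!tofracM tofrac_eq. Qed.

Lemma fracderE p q : q != 0 ->
  fracder (p%:F / q%:F) = (d p * q - p * d q)%:F / (q ^+ 2)%:F.
Proof.
move=> q0; rewrite /fracder; set f := p%:F / _.
have m0 : \d_(repr f) != 0 by exact: denom_ratioP.
have /eqP : p%:F / q%:F = _ := frac_repr f; rewrite eq_frac //.
move: (\n_ _) (\d_ _) m0 => u m m0 /eqP e.
have /eqP := congr1 d e; rewrite !dM => /eqP de.
apply/eqP; rewrite eq_frac ?expf_neq0 //; apply/eqP.
have -> : (d u * m - u * d m) * q ^+ 2 =
  m * q * (d u * q + u * d q) - m * (u * q) * d q - q * (u * q) * d m by ring.
by rewrite -e -de; ring.
Qed.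

Lemma fracderB : zmod_morphism fracder.
Proof.
move=> f g; have [p [q [q0 ->]]] := fracP f; have [p' [q' [q'0 ->]]] := fracP g.
have F0 x : x != 0 -> x%:F != 0 by rewrite tofrac_eq0.
have -> : p%:F / q%:F - p'%:F / q'%:F = (p * q' - p' * q)%:F / (q * q')%:F.
  by rewrite tofracB !tofracM quot_subE ?F0.
rewrite !fracderE ?mulf_neq0 // (raddfB d) !dM !expr2.
by rewrite !(tofracB, tofracD, tofracM) quot_derB ?F0.
Qed.

Lemma fracderM f g : fracder (f * g) = fracder f * g + f * fracder g.
Proof.
have [p [q [q0 ->]]] := fracP f; have [p' [q' [q'0 ->]]] := fracP g.
have F0 x : x != 0 -> x%:F != 0 by rewrite tofrac_eq0.
have -> : p%:F / q%:F * (p'%:F / q'%:F) = (p * p')%:F / (q * q')%:F.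
  by rewrite !tofracM mulf_div.
rewrite !fracderE ?mulf_neq0 // !dM !expr2.
by rewrite !(tofracB, tofracD, tofracM) quot_derM ?F0.
Qed.

Lemma fracder_tofrac p : fracder p%:F = (d p)%:F.
Proof.
have d1 : d 1 = 0.
  have /eqP := dM 1 1; rewrite !mulr1 mul1r -subr_eq0 opprD addrA subrr sub0r.
  by rewrite oppr_eq0 => /eqP.
have -> : p%:F = p%:F / 1%:F by rewrite tofrac1 divr1.
by rewrite fracderE ?oner_eq0 // d1 mulr0 subr0 expr1n mulr1 tofrac1 divr1.
Qed.

End FracDer.

Lemma fracderC (R : idomainType) (d d' : {additive R -> R}) :
  (forall a b, d (a * b) = d a * b + a * d b) ->
  (forall a b, d' (a * b) = d' a * b + a * d' b) ->
  (forall a, d (d' a) = d' (d a)) ->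
  forall f, fracder d (fracder d' f) = fracder d' (fracder d f).
Proof.
move=> dM d'M dC f; have [p [q [q0 ->]]] := fracP f.
rewrite !fracderE ?expf_neq0 // !expr2 !(raddfB d) !(raddfB d') !(dM, d'M) !dC.
by congr (FracField.tofrac _ / _); ring.
Qed.

Section Weyl.
Variables (C : fieldType) (n : nat).

Definition polyDiffRing : diffRing n :=
  @DiffRing n {mpoly C[n]} (fun i => mderiv i)
    (fun i a b => mderivM i a b) (fun i j a => mderiv_comm j i a).

Definition mderiv_add (i : 'I_n) : {additive {mpoly C[n]} -> {mpoly C[n]}} :=
  mderiv i.

HB.instance Definition _ (i : 'I_n) := GRing.isZmodMorphism.Build
  {fraction {mpoly C[n]}} {fraction {mpoly C[n]}} (fracder (mderiv_add i))
  (fracderB (mderivM i)).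

Definition ratDiffRing : diffRing n :=
  @DiffRing n {fraction {mpoly C[n]}} (fun i => fracder (mderiv_add i))
    (fun i => fracderM (mderivM i))
    (fun i j => fracderC (mderivM i) (mderivM j) (mderiv_comm j i)).

Local Notation weyl := (diffop polyDiffRing).
Local Notation ratweyl := (diffop ratDiffRing).

Definition weyl_to_rat (P : weyl) : ratweyl :=
  map_mpoly (@FracField.tofrac {mpoly C[n]}) P.

Definition weylC (c : C) : weyl := @coef_op n polyDiffRing c%:MP.

(* C[D] inside the Weyl algebra *)
Definition weylD (f : {mpoly C[n]}) : weyl := map_mpoly (@mpolyC n C) f.

Definition theta (j : 'I_n) : weyl :=
  @coef_op n polyDiffRing 'X_j * partial polyDiffRing j.

(* p(theta_1, ..., theta_n), as an element of C(x)<D> *)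
Definition theta_eval (p : {mpoly C[n]}) : ratweyl :=
  mmap (fun c => weyl_to_rat (weylC c)) (fun j => weyl_to_rat (theta j)) p.

End Weyl.

(* Notations, not definitions: the ring structure is that of [diffop]. *)
Notation weyl C n := (diffop (polyDiffRing C n)).
Notation ratweyl C n := (diffop (ratDiffRing C n)).

Definition lideal (T : nzRingType) (S : T -> Prop) (x : T) : Prop :=
  exists (k : nat) (c s : 'I_k -> T),
    (forall i, S (s i)) /\ x = \sum_(i < k) c i * s i.

Section Initial.
Variables (C : fieldType) (R : realDomainType) (n : nat) (w : 'cV[R]_n).

Definition wdeg (m : 'X_{1..n}) : R := \sum_j w j 0 * (m j)%:R.

Definition in_form (f : {mpoly C[n]}) : {mpoly C[n]} :=
  \sum_(m <- msupp f | all (fun m' => wdeg m' <= wdeg m) (msupp f))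
    f@_m *: 'X_[m].

Definition in_ideal (I : {mpoly C[n]} -> Prop) : {mpoly C[n]} -> Prop :=
  lideal (fun f => exists2 g, I g & f = in_form g).

(* the pairs (a, b) such that x^a D^b occurs in the normal form of P *)
Definition weyl_supp (P : {mpoly {mpoly C[n]}[n]}) :
    seq ('X_{1..n} * 'X_{1..n}) :=
  [seq (a, b) | b <- msupp P, a <- msupp P@_b].

Definition weyl_wdeg (ab : 'X_{1..n} * 'X_{1..n}) : R :=
  wdeg ab.2 - wdeg ab.1.

Definition weyl_in_form (P : {mpoly {mpoly C[n]}[n]}) :
    {mpoly {mpoly C[n]}[n]} :=
  \sum_(ab <- weyl_supp P |
        all (fun ab' => weyl_wdeg ab' <= weyl_wdeg ab) (weyl_supp P))
    ((P@_ab.2)@_ab.1 *: 'X_[ab.1]) *: 'X_[ab.2].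

(* in_(-w,w)(H), as a left ideal of the Weyl algebra *)
Definition weyl_in_ideal (H : weyl C n -> Prop) : weyl C n -> Prop :=
  lideal (fun P : weyl C n => exists2 Q, H Q & P = weyl_in_form Q).

(* ind_w(H) = (C(x)<D> in_(-w,w)(H)) \cap C[theta] *)
Definition ind_ideal (H : weyl C n -> Prop) (p : {mpoly C[n]}) : Prop :=
  lideal (fun Q : ratweyl C n => exists2 P, weyl_in_ideal H P & Q = weyl_to_rat P)
    (theta_eval p).

Definition is_exponent (H : weyl C n -> Prop) (v : 'cV[C]_n) : Prop :=
  forall p, ind_ideal H p -> p.@[fun j => v j 0] = 0.

Definition is_monomial_ideal (I : {mpoly C[n]} -> Prop) : Prop :=
  exists S : 'X_{1..n} -> Prop,
    forall f, I f <-> lideal (fun q => exists2 m, S m & q = 'X_[m]) f.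

(* G is the reduced Groebner basis of I with respect to w; meant for an ideal I
   that is homogeneous for some positive grading and such that in_w(I) is
   monomial, so that in_w(I) is the initial ideal for any term order refining w
   and no tie-breaking order is needed. *)
Definition is_reduced_gb (I : {mpoly C[n]} -> Prop) (G : seq {mpoly C[n]}) :
    Prop :=
  [/\ uniq G,
      {in G, forall g, I g},
      forall f, in_ideal I f <->
        lideal (fun q => exists2 g, g \in G & q = in_form g) f,
      {in G, forall g, exists m, in_form g = 'X_[m]} &
      {in G, forall g, {in msupp g, forall m,
        ~ lideal (fun q => exists g', [/\ g' \in G, g' != g & q = in_form g'])
            'X_[m]}}].

End Initial.

(* w lies in the interior of a maximal cone of the small Groebner fan of H, i.e.
   in_(-w,w)(H) does not change under small perturbations of w *)
Definition generic_weight (C : fieldType) (R : realDomainType) (n : nat)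
    (H : weyl C n -> Prop) (w : 'cV[R]_n) : Prop :=
  exists2 e : R, 0 < e &
    forall w' : 'cV[R]_n, (forall j, `|w' j 0 - w j 0| < e) ->
    forall P, weyl_in_ideal w' H P <-> weyl_in_ideal w H P.

Section Vectors.
Variable n : nat.

Definition mnm_vec (u : 'X_{1..n}) : 'cV[int]_n := \col_j (u j)%:Z.

Definition vpos (u : 'cV[int]_n) : 'X_{1..n} :=
  [multinom (if (0 <= u j 0)%R then `|u j 0%R|%N else 0%N) | j < n].

Definition vneg (u : 'cV[int]_n) : 'X_{1..n} := vpos (- u).

Variable C : fieldType.

Definition binomial_of (u : 'cV[int]_n) : {mpoly C[n]} :=
  'X_[vpos u] - 'X_[vneg u].

(* [v]_u *)
Definition falling (v : 'cV[C]_n) (u : 'X_{1..n}) : C :=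
  \prod_j \prod_(k < u j) (v j 0 - k%:R).

Definition nsupp (v : 'cV[C]_n) : {set 'I_n} :=
  [set j | `[< exists k : nat, v j 0 = - k.+1%:R >]].

(* I_u = nsupp(v + u) *)
Definition nsupp_shift (v : 'cV[C]_n) (u : 'cV[int]_n) : {set 'I_n} :=
  nsupp (v + map_mx intr u).

End Vectors.

Section Hypergeometric.
Variables (d n : nat) (A : 'M[int]_(d, n)).

(* the columns of A lie on a hyperplane of Q^d missing the origin *)
Definition homogeneous_mx : Prop :=
  exists (c : 'rV[rat]_d) (e : rat),
    [/\ c != 0, e != 0 & forall j, \sum_i c 0 i * (A i j)%:~R = e].

Definition in_lattice (u : 'cV[int]_n) : Prop := A *m u = 0.

Definition is_lattice_basis (h : nat) (B : 'M[int]_(n, h)) : Prop :=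
  (forall k, in_lattice (col k B)) /\
  (forall u, in_lattice u -> exists! c : 'cV[int]_h, u = B *m c).

Variable C : fieldType.

Definition toric_ideal : {mpoly C[n]} -> Prop :=
  lideal (fun f => exists u u' : 'X_{1..n},
    A *m mnm_vec u = A *m mnm_vec u' /\ f = 'X_[u] - 'X_[u']).

Definition hypergeometric_ideal (beta : 'cV[C]_d) : weyl C n -> Prop :=
  lideal (fun P : weyl C n =>
    (exists2 f, toric_ideal f & P = weylD f) \/
    (exists i, P = \sum_j theta C j *~ A i j - weylC n (beta i 0))).

Definition is_fake_exponent (R : realDomainType) (beta : 'cV[C]_d)
    (w : 'cV[R]_n) (v : 'cV[C]_n) : Prop :=
  map_mx intr A *m v = beta /\
  forall u, in_lattice u -> wdeg w (vneg u) < wdeg w (vpos u) ->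
    falling v (vpos u) = 0.

Definition in_Cw (M : nat) (g : 'I_M -> 'cV[int]_n) (u : 'cV[int]_n) : Prop :=
  exists c : 'I_M -> nat, u = \sum_i g i *+ c i.

Section Supports.
Variables (M : nat) (g : 'I_M -> 'cV[int]_n) (v : 'cV[C]_n).
Variables (h : nat) (B : 'M[int]_(n, h)).

Definition NSw (I : {set 'I_n}) : Prop :=
  exists u, [/\ in_lattice u, I = nsupp_shift v u &
    forall u', in_lattice u' -> nsupp_shift v u' = I -> in_Cw g u'].

Definition supp_mx : {set 'I_n} := [set j | row j B != 0].

Definition NN (I : {set 'I_n}) : Prop :=
  NSw I /\ supp_mx :|: I = supp_mx :|: nsupp_shift v 0.

Definition NNc (I : {set 'I_n}) : Prop :=
  (exists u, [/\ in_lattice u, I = nsupp_shift v u &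
    supp_mx :|: I = supp_mx :|: nsupp_shift v 0]) /\ ~ NN I.

Definition KN : {set 'I_n} := \bigcap_(I : {set 'I_n} | `[< NN I >]) I.

Definition Bs (j : 'I_n) : {mpoly C[h]} := \sum_k (B j k)%:~R *: 'X_k.

Definition Bs_prod (J : {set 'I_n}) : {mpoly C[h]} := \prod_(j in J) Bs j.

Definition mN : {mpoly C[h]} := Bs_prod (nsupp_shift v 0 :\: KN).

Definition PN : {mpoly C[h]} -> Prop :=
  lideal (fun f => exists I J, [/\ NN I, NNc J &
    f = Bs_prod ((I :|: J) :\: KN)]).

End Supports.
End Hypergeometric.

(* Main.v *)
(** Frobenius method without logarithms.  Let [z = v + B s], with coordinates in
  the field of rational functions of [s], and let the Weyl algebra act on formal sums
  [\sum_u Phi(u) x^(z + u)], [u] in Z^n.  The coefficients of the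
  Gamma-type series, multiplied by [m(s)] and supported on the [u] in [L] with [I_u] in
  the family N, are regular at [s = 0], and the series is annihilated by [H_A(beta)]
  modulo the extension of [P_N] to the local ring at [s = 0]: an error term appears only
  between some [I_u] in N and some [I_u'] outside N, and it is divisible by
  [(B s)^((I_u \cup I_u') \ K)].  As the support lies in [C(w)], the lowest term of the
  series is [m(s) x^z] and is annihilated by the initial ideal.  So if [p] is in the
  indicial ideal, then [p(z) m(s)] lies in the extension of [P_N]; if [p(v) <> 0], then
  [p(z)] is a unit at [s = 0], and since [P_N] is homogeneous, [m(s)] is in [P_N]. *)

Require Import Defs.
From HB Require Import structures.
From mathcomp Require Import all_boot all_order all_algebra fraction ring.
From mathcomp Require Import boolp reals.
From mathcomp Require Import complex ssrcomplements mpoly.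

Set Implicit Arguments.
Unset Strict Implicit.
Unset Printing Implicit Defensive.

Import Order.TTheory GRing.Theory Num.Theory.
Local Open Scope ring_scope.

(** * The Weyl algebra acting on formal sums *)

Section LinearExtension.
Variables (n : nat) (K : nzRingType) (V : zmodType) (G : 'X_{1..n} -> K -> V).

(** Only additivity in the coefficient is asked of [G]: in [act] the coefficient is a polynomial in
    x, which moves the index and is no scalar on the values. *)
Definition mlin (p : {mpoly K[n]}) : V := \sum_(m <- msupp p) G m p@_m.

Hypothesis GB : forall m, zmod_morphism (G m).

Lemma mlin_coef0 m : G m 0 = 0.
Proof. by have := GB m 0 0; rewrite !subrr. Qed.

Lemma mlinwE k p : (msize p <= k)%N ->
  mlin p = \sum_(m : 'X_{1..n < k}) G m p@_m.
Proof.
move=> le_pk; set I : subFinType _ := 'X_{1..n < k}.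
rewrite /mlin (big_mksub I) ?msupp_uniq //=; first last.
  by move=> x /msize_mdeg_lt /leq_trans; apply.
by rewrite big_rmcond //= => j /memN_msupp_eq0 ->; apply: mlin_coef0.
Qed.

Lemma mlinB : zmod_morphism mlin.
Proof.
move=> p q; pose k := maxn (msize (p - q)) (maxn (msize p) (msize q)).
rewrite !(@mlinwE k) ?leq_max ?leqnn ?orbT // -sumrB.
by apply: eq_bigr => m _; rewrite mcoeffB GB.
Qed.

HB.instance Definition _ := GRing.isZmodMorphism.Build {mpoly K[n]} V mlin mlinB.

Lemma mlin0 : mlin 0 = 0. Proof. exact: raddf0. Qed.
Lemma mlinD : {morph mlin : p q / p + q}. Proof. exact: raddfD. Qed.

Lemma mlinZX c m : mlin (c *: 'X_[m]) = G m c.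
Proof.
have [->|c0] := eqVneq c 0; first by rewrite scale0r mlin0 mlin_coef0.
by rewrite /mlin msuppMCX // big_seq1 mcoeffZ mcoeffX eqxx mulr1.
Qed.

End LinearExtension.

Definition ffall (F : pzRingType) (n : nat) (t : 'I_n -> F) (b : 'X_{1..n}) : F :=
  \prod_j \prod_(k < b j) (t j - k%:R).

Lemma mnm_vecD n (a b : 'X_{1..n}) : mnm_vec (a + b)%MM = mnm_vec a + mnm_vec b.
Proof. by apply/colP=> j; rewrite !mxE mnmDE PoszD. Qed.

Lemma ffallDU (F : comPzRingType) n (t : 'I_n -> F) b i :
  ffall t (b + U_(i))%MM = ffall t b * (t i - (b i)%:R).
Proof.
rewrite /ffall (bigD1 i) //= [in RHS](bigD1 i) //= mnmDE mnm1E eqxx addn1.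
rewrite big_ord_recr /= -!mulrA; congr (_ * _); rewrite mulrC; congr (_ * _).
by apply: eq_bigr => j ji; rewrite mnmDE mnm1E eq_sym (negPf ji) addn0.
Qed.

Section Action.
Variables (n : nat) (C : fieldType) (F : comNzRingType) (iota : {rmorphism C -> F}).
Variable z : 'I_n -> F.
Implicit Types (P Q : weyl C n) (y : 'cV[int]_n) (a b : 'X_{1..n}).
Variable Phi : 'cV[int]_n -> F.

Definition zshift y (j : 'I_n) : F := z j + (y j 0)%:~R.

(* [Phi] stands for [\sum_y Phi(y) x^(z + y)], so that
   [(D^b Phi)(y) = [z + y + b]_b Phi(y + b)] and [(x^a Phi)(y) = Phi(y - a)]. *)
Definition der_act b y : F := ffall (zshift (y + mnm_vec b)) b * Phi (y + mnm_vec b).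

Definition coef_act y b : {mpoly C[n]} -> F :=
  mlin (fun a c => iota c * der_act b (y - mnm_vec a)).

Definition act P y : F := mlin (coef_act y) P.

Lemma mono_actB y b a : zmod_morphism (fun c => iota c * der_act b (y - mnm_vec a)).
Proof. by move=> c c'; rewrite rmorphB mulrBl. Qed.

Lemma coef_actB y b : zmod_morphism (coef_act y b).
Proof. exact: mlinB (mono_actB y b). Qed.

Lemma coef_actZX y b c a : coef_act y b (c *: 'X_[a]) = iota c * der_act b (y - mnm_vec a).
Proof. exact: mlinZX (mono_actB y b) _ _. Qed.

Lemma actB y : zmod_morphism (act^~ y).
Proof. exact: mlinB (coef_actB y). Qed.

Lemma act0 y : act 0 y = 0.
Proof. exact: mlin0 (coef_actB y). Qed.

Lemma actD y : {morph act^~ y : P Q / P + Q}.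
Proof. exact: mlinD (coef_actB y). Qed.

Lemma actZX y f b : act (f *: 'X_[b]) y = coef_act y b f.
Proof. exact: mlinZX (coef_actB y) _ _. Qed.

Lemma act_mono y c a b : act (c *: 'X_[a] *: 'X_[b]) y = iota c * der_act b (y - mnm_vec a).
Proof. by rewrite actZX coef_actZX. Qed.

Lemma act_sum y (I : Type) (r : seq I) (p : pred I) (f : I -> weyl C n) :
  act (\sum_(i <- r | p i) f i) y = \sum_(i <- r | p i) act (f i) y.
Proof. exact: (big_morph (act^~ y) (actD y) (act0 y)). Qed.

Lemma weyl_ind (T : weyl C n -> Prop) : T 0 -> (forall P Q, T P -> T Q -> T (P + Q)) ->
  (forall (c : C) (a b : 'X_{1..n}), T (c *: 'X_[a] *: 'X_[b])) -> forall P, T P.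
Proof.
move=> T0 TD TX P; elim/mpolyind: P => [//|f b P _ _ TP]; apply: (TD) => //.
elim/mpolyind: f => [|c a f _ _ Tf]; first by rewrite scale0r.
by rewrite scalerDl; exact: TD _ _ (TX _ _ _) Tf.
Qed.

Lemma actZ y c a Q : act (c *: 'X_[a] *: Q) y = iota c * act Q (y - mnm_vec a).
Proof.
elim/weyl_ind: Q => [|P Q IHP IHQ|c' a' b]; first by rewrite scaler0 !act0 mulr0.
  by rewrite scalerDr [LHS]actD IHP IHQ actD mulrDr.
have -> : c *: 'X_[a] *: (c' *: 'X_[a'] *: 'X_[b]) = (c * c') *: 'X_[a + a'] *: 'X_[b]
    :> weyl C n.
  by rewrite scalerA -scalerAl -scalerAr scalerA mpolyXD.
rewrite !act_mono rmorphM mulrA; congr (_ * _ * der_act _ _).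
by rewrite mnm_vecD opprD addrA.
Qed.

Lemma der_actDU i b y :
  der_act (b + U_(i))%MM y = (zshift y i + 1) * der_act b (y + mnm_vec U_(i)).
Proof.
rewrite /der_act mnm_vecD [mnm_vec b + _]addrC addrA ffallDU mulrAC [RHS]mulrC.
by congr (_ * _); rewrite /zshift !mxE mnm1E eqxx /= !intrD -!pmulrn; ring.
Qed.

(** With e_i = [U_(i)], D_i x^(z + y + e_i) = (z_i + y_i + 1) x^(z + y). On x^a D^b the Leibniz rule
    gives a_i x^(a - e_i) D^b + x^a D^(b + e_i), and the scalars a_i and z_i + y_i - a_i + 1 add
    up. *)
Lemma act_lmulD y i Q : act (lmulD.body i Q) y =
  (zshift y i + 1) * act Q (y + mnm_vec U_(i)).
Proof.
elim/weyl_ind: Q => [|P Q IHP IHQ|c a b].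
- by rewrite raddf0 !act0 mulr0.
- by rewrite lmulDD [LHS]actD IHP IHQ actD mulrDr.
rewrite lmulDZ lmulDX [LHS]actD [der _ _ _]mderivZ mderivX scalerA.
transitivity (iota (c * (a i)%:R) * der_act b (y - mnm_vec (a - U_(i))) +
    iota c * der_act (b + U_(i))%MM (y - mnm_vec a)).
  by congr (_ + _); apply: act_mono.
rewrite [in RHS]act_mono rmorphM rmorph_nat der_actDU -!mulrA -mulrDr [RHS]mulrCA.
congr (_ * _); rewrite [y + _ - _]addrAC.
(* The subtraction in [a - U_(i)] is truncated at a_i = 0, where the factor a_i kills the term. *)
have -> : (a i)%:R * der_act b (y - mnm_vec (a - U_(i))) =
    (a i)%:R * der_act b (y - mnm_vec a + mnm_vec U_(i)).
  have [->|ai] := posnP (a i); first by rewrite !mul0r.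
  have eqa : mnm_vec a = mnm_vec (a - U_(i)) + mnm_vec U_(i).
    by rewrite -mnm_vecD submK // lep1mP -lt0n.
  by rewrite [in RHS]eqa opprD addrA addrNK.
rewrite -mulrDl addrAC; congr (_ * _).
by rewrite /zshift !mxE rmorphB /= -pmulrn; ring.
Qed.

(** The x_i and D_i generate the Weyl algebra over C, so the compatibility of [act] with products is
    needed only in the cases [actZ] and [act_lmulD]. *)
Lemma weyl_lideal_ind (T : weyl C n -> Prop) :
  T 0 -> (forall P Q, T P -> T Q -> T (P + Q)) ->
  (forall i Q, T Q -> T (lmulD.body i Q)) ->
  (forall (c : C) (a : 'X_{1..n}) (Q : {mpoly polyDiffRing C n[n]}),
     T Q -> T (c *: 'X_[a] *: Q)) ->
  forall P Q : weyl C n, T Q -> T (P * Q).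
Proof.
move=> T0 TD Tder TX P Q TQ; elim/weyl_ind: P => [|P P' IH IH'|c a b].
- by rewrite mul0r.
- by rewrite mulrDl; apply: TD.
rewrite [_ * _]diffop_mulZX; apply: TX.
elim/mnm_ind: b => [|b i IH]; first by rewrite lmulDm0.
by rewrite lmulDmDU; apply: Tder.
Qed.

Section Annihilator.
Variable Z : F -> Prop.
Hypotheses (Z0 : Z 0) (ZD : forall f g, Z f -> Z g -> Z (f + g)).
Hypothesis ZC : forall c f, Z f -> Z (iota c * f).
Hypothesis Zz : forall y i f, Z f -> Z ((zshift y i + 1) * f).

(** [Z] will be the extension of P_N to the local ring. The operators annihilating the series modulo
    [Z] form a left ideal, since constants and the z_i + y_i + 1 preserve [Z]. *)
Lemma act_lideal (S : weyl C n -> Prop) :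
  (forall P, S P -> forall y, Z (act P y)) ->
  forall P, lideal S P -> forall y, Z (act P y).
Proof.
move=> ZS _ [k [c [s [Ss ->]]]] y; rewrite act_sum.
elim/big_ind: _ => // i _; have ZT := ZS _ (Ss i); move: (s i) ZT => Q ZQ.
pose T P := forall y, Z (act P y).
apply: (@weyl_lideal_ind T) => // [y'|P P' TP TP' y'|j P TP y'|c' a P TP y'].
- by rewrite act0.
- by rewrite actD; apply: ZD.
- by rewrite act_lmulD; apply: Zz.
- by rewrite actZ; apply: ZC.
Qed.

End Annihilator.

End Action.

Section ActGenerators.
Variables (n : nat) (C : fieldType) (F : comNzRingType) (iota : {rmorphism C -> F}).
Variables (z : 'I_n -> F) (Phi : 'cV[int]_n -> F).
Implicit Types (P Q : weyl C n) (y : 'cV[int]_n) (a b : 'X_{1..n}).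
Local Notation act := (act iota z Phi).
Local Notation der_act := (der_act z Phi).

Lemma zshift_subU y j : zshift z (y - mnm_vec U_(j)) j + 1 = zshift z y j.
Proof. by rewrite /zshift !mxE mnm1E eqxx rmorphB /= addrA subrK. Qed.

Lemma der_act0 y : der_act 0%MM y = Phi y.
Proof.
have -> : der_act 0%MM y = Phi (y + mnm_vec 0%MM).
  by rewrite /der_act /ffall big1 ?mul1r // => j _; rewrite mnm0E big_ord0.
by congr Phi; apply/colP=> j; rewrite !mxE mnm0E addr0.
Qed.

Lemma mnm_vec0 : mnm_vec 0%MM = 0 :> 'cV[int]_n.
Proof. by apply/colP=> j; rewrite !mxE mnm0E. Qed.

Lemma act1 y : act 1 y = Phi y.
Proof.
have -> : (1 : weyl C n) = 1 *: 'X_[0] *: 'X_[0] by rewrite !mpolyX0 scale1r scale1r.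
by rewrite act_mono rmorph1 mul1r der_act0 mnm_vec0 subr0.
Qed.

Lemma mpolyC_ZX c : c%:MP = c *: 'X_[0] :> {mpoly C[n]}.
Proof. by rewrite mpolyX0 -alg_mpolyC. Qed.

Lemma act_weylC y c Q : act (weylC n c * Q) y = iota c * act Q y.
Proof.
by rewrite /weylC coef_op_mul mpolyC_ZX actZ mnm_vec0 subr0.
Qed.

(** Multiplication by x_j undoes the shift of the index by D_j, so x^(z + y) is an eigenvector.
    Euler operators and polynomials in theta hence act diagonally. *)
Lemma act_theta y j Q : act (theta C j * Q) y = zshift z y j * act Q y.
Proof.
rewrite /theta -mulrA partial_mul coef_op_mul.
have -> : 'X_j = 1 *: 'X_j :> {mpoly C[n]} by rewrite scale1r.
by rewrite actZ act_lmulD zshift_subU subrK rmorph1 mul1r.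
Qed.

Lemma actMz y P m : act (P *~ m) y = act P y *~ m.
Proof.
pose f : {additive weyl C n -> F} :=
  HB.pack (act^~ y) (GRing.isZmodMorphism.Build _ _ _ (actB iota z Phi y)).
exact: (raddfMz f).
Qed.

Lemma act_euler y (k : 'I_n -> int) beta :
  act (\sum_j theta C j *~ k j - weylC n beta) y =
  (\sum_j zshift z y j *~ k j - iota beta) * Phi y.
Proof.
rewrite actB act_sum -[weylC n beta]mulr1 act_weylC act1 mulrBl mulr_suml.
by congr (_ - _); apply: eq_bigr => j _; rewrite actMz -[theta C j]mulr1 act_theta act1 mulrzAl.
Qed.

Lemma act_thetaX y j k Q : act (theta C j ^+ k * Q) y = zshift z y j ^+ k * act Q y.
Proof.
elim: k => [|k IH]; first by rewrite !expr0 !mul1r.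
rewrite exprS -(mulrA (theta C j)).
by rewrite act_theta IH exprS mulrA.
Qed.

Lemma act_theta_poly y (p : {mpoly C[n]}) :
  act (mmap (@weylC C n) (@theta C n) p) y = mmap iota (zshift z y) p * Phi y.
Proof.
rewrite /mmap act_sum mulr_suml; apply: eq_bigr => m _.
rewrite act_weylC -[RHS]mulrA; congr (_ * _); rewrite /mmap1.
elim: (index_enum _) => [|i s IH]; first by rewrite !big_nil act1 mul1r.
by rewrite !big_cons act_thetaX -[in RHS]mulrA -IH.
Qed.

Lemma act_weylDZX y c b : act (weylD (c *: 'X_[b])) y = iota c * der_act b y.
Proof.
have -> : weylD (c *: 'X_[b]) = c *: 'X_[0] *: 'X_[b].
  by rewrite /weylD map_mpolyZ map_mpolyX -mpolyC_ZX.
by rewrite act_mono mnm_vec0 subr0.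
Qed.

Section Toric.
Variables (d : nat) (A : 'M[int]_(d, n)) (Z : F -> Prop).
Hypotheses (Z0 : Z 0) (ZD : forall f g, Z f -> Z g -> Z (f + g)).
Hypothesis ZC : forall c f, Z f -> Z (iota c * f).
Hypothesis Zder : forall a a', A *m mnm_vec a = A *m mnm_vec a' ->
  forall y, Z (der_act a y - der_act a' y).

(** D^m (D^u - D^u') = D^(m + u) - D^(m + u') is again a difference of monomials of the same
    A-degree, to which [Zder] applies. *)
Lemma act_toric f : toric_ideal A f -> forall y, Z (act (weylD f) y).
Proof.
have D0 : weylD (0 : {mpoly C[n]}) = 0 by rewrite /weylD raddf0.
have DD p q : weylD (p + q : {mpoly C[n]}) = weylD p + weylD q by rewrite /weylD raddfD.
have DB p q : weylD (p - q : {mpoly C[n]}) = weylD p - weylD q by rewrite /weylD raddfB.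
case=> k [c [s [Ss ->]]] y.
rewrite (big_morph _ DD D0) act_sum.
elim/big_ind: _ => // i _; have [u [u' [euu' ->]]] := Ss i.
elim/mpolyind: (c i) => [|e m p _ _ IH]; first by rewrite mul0r D0 act0.
rewrite mulrDl DD actD; apply: ZD; last exact: IH.
have -> : e *: 'X_[m] * ('X_[u] - 'X_[u']) = e *: 'X_[m + u] - e *: 'X_[m + u'].
  by rewrite -scalerAl mulrBr -!mpolyXD scalerBr.
rewrite DB actB.
have eqD b : act (weylD (e *: 'X_[b])) y = iota e * der_act b y by exact: act_weylDZX.
have := ZC e (@Zder (m + u)%MM (m + u')%MM _ y).
rewrite mulrBr -!eqD; apply.
by rewrite !mnm_vecD !mulmxDr euu'.
Qed.

End Toric.

End ActGenerators.

(** * Clearing denominators in the rational Weyl algebra *)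

Section DiffopMap.
Variables (n : nat) (K K' : diffRing n) (phi : {rmorphism K -> K'}).
Hypothesis phi_der : forall i f, phi (der K i f) = der K' i (phi f).

Definition diffop_map (P : diffop K) : diffop K' := map_mpoly phi P.

Lemma diffop_mapB : zmod_morphism diffop_map.
Proof. by move=> P Q; rewrite /diffop_map raddfB. Qed.

Lemma diffop_map_lmulD i (Q : {mpoly K[n]}) :
  map_mpoly phi (lmulD.body i Q) = lmulD.body i (map_mpoly phi Q).
Proof.
rewrite !lmulD.unlock raddfD /= rmorphM /= map_mpolyX; congr (_ + _).
by apply/mpolyP=> m; rewrite !mcoeff_map_mpoly /= phi_der.
Qed.

Lemma diffop_map_lmulDm b (Q : {mpoly K[n]}) :
  map_mpoly phi (lmulDm b Q) = lmulDm b (map_mpoly phi Q).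
Proof.
elim/mnm_ind: b => [|b i IH]; first by rewrite !lmulDm0.
by rewrite !lmulDmDU diffop_map_lmulD IH.
Qed.

Lemma diffop_map_mul (P Q : {mpoly K[n]}) :
  map_mpoly phi (diffop_mul P Q) = diffop_mul (map_mpoly phi P) (map_mpoly phi Q).
Proof.
elim/mpolyind: P => [|f b P _ _ IH]; first by rewrite diffop_mul0l !raddf0 diffop_mul0l.
rewrite diffop_mulDl !raddfD /= diffop_mulDl IH; congr (_ + _).
by rewrite map_mpolyZ map_mpolyX !diffop_mulZX map_mpolyZ diffop_map_lmulDm.
Qed.

Lemma diffop_map_monoid : monoid_morphism diffop_map.
Proof.
split=> [|P Q]; last exact: diffop_map_mul.
by rewrite /diffop_map; apply: (rmorph1 (map_mpoly phi)).
Qed.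

Lemma diffop_map_inj : injective phi -> injective diffop_map.
Proof.
move=> phiI P Q /mpolyP ePQ; apply/mpolyP=> m; have := ePQ m.
by rewrite !mcoeff_map_mpoly => /phiI.
Qed.

End DiffopMap.

Section RationalWeyl.
Variables (C : fieldType) (n : nat).
Local Notation to_rat := (@weyl_to_rat C n).

Lemma weyl_to_ratB : zmod_morphism to_rat.
Proof. exact: (@diffop_mapB n (polyDiffRing C n) (ratDiffRing C n) (@FracField.tofrac {mpoly C[n]})). Qed.

Lemma weyl_to_rat_monoid : monoid_morphism to_rat.
Proof.
apply: (@diffop_map_monoid n (polyDiffRing C n) (ratDiffRing C n) (@FracField.tofrac {mpoly C[n]})).
by move=> i f; rewrite /= (fracder_tofrac (@mderivM _ _ i)).
Qed.

HB.instance Definition _ := GRing.isZmodMorphism.Build _ _ to_rat weyl_to_ratB.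
HB.instance Definition _ := GRing.isMonoidMorphism.Build _ _ to_rat weyl_to_rat_monoid.

Lemma weyl_to_ratD P Q : to_rat (P + Q) = to_rat P + to_rat Q.
Proof. exact: raddfD. Qed.

Lemma weyl_to_ratM P Q : to_rat (P * Q) = to_rat P * to_rat Q.
Proof. exact: rmorphM. Qed.

Lemma weyl_to_rat_inj : injective to_rat.
Proof.
apply: (@diffop_map_inj n (polyDiffRing C n) (ratDiffRing C n) (@FracField.tofrac {mpoly C[n]})).
by move=> f f' /eqP; rewrite tofrac_eq => /eqP.
Qed.

Lemma theta_evalE p : theta_eval p = to_rat (mmap (@weylC C n) (@theta C n) p).
Proof.
rewrite /theta_eval /mmap rmorph_sum; apply: eq_bigr => m _.
rewrite rmorphM; congr (_ * _); rewrite /mmap1 rmorph_prod.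
by apply: eq_bigr => i _; rewrite rmorphXn.
Qed.

Lemma clear_denominators (Q : {mpoly {fraction {mpoly C[n]}}[n]}) :
  exists (f : {mpoly C[n]}) (P : {mpoly {mpoly C[n]}[n]}),
  f != 0 /\ map_mpoly (@FracField.tofrac _) P = FracField.tofrac f *: Q.
Proof.
elim/mpolyind: Q => [|q m Q _ _ [f [P [f0 eP]]]].
  by exists 1, 0; rewrite oner_neq0 raddf0 scaler0.
have [p' [q' [q'0 ->]]] := fracP q.
exists (q' * f), ((f * p') *: 'X_[m] + q' *: P); split; first exact: mulf_neq0.
have clear (K : fieldType) (a b c : K) : a != 0 -> a * b * (c / a) = b * c.
  by move=> a0; rewrite [a * b]mulrC -mulrA [a * _]mulrC divfK.
have e : FracField.tofrac (q' * f) * (FracField.tofrac p' / FracField.tofrac q') =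
    FracField.tofrac (f * p').
  by rewrite !tofracM clear // tofrac_eq0.
rewrite raddfD /= !map_mpolyZ eP map_mpolyX.
by rewrite scalerDr [in RHS]scalerA e scalerA -tofracM.
Qed.

Local Notation coefP := (@coef_op n (polyDiffRing C n)).
Local Notation coefR f := (@coef_op n (ratDiffRing C n) (@FracField.tofrac {mpoly C[n]} f)).

Lemma weyl_to_rat_coef f : to_rat (coefP f) = coefR f.
Proof. exact: map_mpolyC. Qed.

Lemma coef_opM (K : diffRing n) (f g : K) :
  coef_op (f * g) = coef_op f * coef_op g.
Proof. by rewrite coef_op_mul /coef_op mpolyCM mul_mpolyC. Qed.

Lemma weyl_clear_denominators (Q : ratweyl C n) :
  exists (f : {mpoly C[n]}) (P : weyl C n), f != 0 /\ to_rat P = coefR f * Q.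
Proof.
have [f [P [f0 eP]]] := clear_denominators Q; exists f, P; split=> //.
by rewrite coef_op_mul; exact: eP.
Qed.

(** Denominators stand on the left, so multiplying by a polynomial clears them. This passes from
    C(x)<D> to the Weyl algebra, which does act on formal sums. *)
Lemma ind_ideal_clear (R : realDomainType) (w : 'cV[R]_n) H (T : weyl C n -> Prop) p :
  T 0 -> (forall P Q, T P -> T Q -> T (P + Q)) -> (forall P Q, T Q -> T (P * Q)) ->
  (forall P, weyl_in_ideal w H P -> T P) -> ind_ideal w H p ->
  exists2 f : {mpoly C[n]}, f != 0 & T (coefP f * mmap (@weylC C n) (@theta C n) p).
Proof.
move=> T0 TD TM TH [k [c [s [Ss ep]]]].
suff [f [P [f0 TP eP]]] : exists f P,
    [/\ f != 0, T P & to_rat P = coefR f * theta_eval p].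
  exists f => //; suff -> : coefP f * mmap (@weylC C n) (@theta C n) p = P by [].
  by apply: weyl_to_rat_inj; rewrite weyl_to_ratM weyl_to_rat_coef -theta_evalE.
rewrite ep; elim/big_ind: _ => [|Q1 Q2 [f1 [P1 [f10 TP1 e1]]] [f2 [P2 [f20 TP2 e2]]]|i _].
- by exists 1, 0; rewrite oner_neq0 raddf0 mulr0.
- exists (f1 * f2), (coefP f2 * P1 + coefP f1 * P2); split; first exact: mulf_neq0.
    by apply: TD; apply: TM.
  rewrite weyl_to_ratD !weyl_to_ratM !weyl_to_rat_coef e1 e2 !mulrA -!coef_opM -!tofracM.
  by rewrite [f2 * f1]mulrC -mulrDr.
have [P HP ->] := Ss i; have [f [c' [f0 ec]]] := weyl_clear_denominators (c i).
exists f, (c' * P); split=> //; first exact/TM/TH.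
by rewrite weyl_to_ratM ec mulrA.
Qed.

End RationalWeyl.

(** * Initial forms *)

Section InitialForm.
Variables (n : nat) (C : fieldType) (F : comNzRingType) (iota : {rmorphism C -> F}).
Variables (z : 'I_n -> F) (R : realDomainType) (w : 'cV[R]_n).
Implicit Types (y u : 'cV[int]_n) (P : weyl C n).

Definition zdeg u : R := \sum_j w j 0 * (u j 0)%:~R.

Lemma zdegD u u' : zdeg (u + u') = zdeg u + zdeg u'.
Proof. by rewrite /zdeg -big_split; apply: eq_bigr => j _; rewrite mxE intrD mulrDr. Qed.

Lemma zdeg0 : zdeg 0 = 0.
Proof. by rewrite /zdeg big1 // => j _; rewrite mxE mulr0. Qed.

Lemma zdegN u : zdeg (- u) = - zdeg u.
Proof. by apply/eqP; rewrite -addr_eq0 -zdegD addNr zdeg0. Qed.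

Lemma zdeg_mnm a : zdeg (mnm_vec a) = wdeg w a.
Proof. by apply: eq_bigr => j _; rewrite mxE -pmulrn. Qed.

Lemma zdeg_shift y a b :
  zdeg (y - mnm_vec a + mnm_vec b) = zdeg y + weyl_wdeg w (a, b).
Proof. by rewrite !zdegD zdegN !zdeg_mnm /weyl_wdeg /= -addrA [_ + wdeg w b]addrC. Qed.

Lemma actE Phi P y : act iota z Phi P y =
  \sum_(ab <- weyl_supp P) iota (P@_ab.2)@_ab.1 * der_act z Phi ab.2 (y - mnm_vec ab.1).
Proof. by rewrite /act /coef_act /mlin /weyl_supp big_allpairs_dep. Qed.

Definition weyl_top P (ab : 'X_{1..n} * 'X_{1..n}) : bool :=
  all (fun ab' => weyl_wdeg w ab' <= weyl_wdeg w ab) (weyl_supp P).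

Lemma act_in_formE Phi P y : act iota z Phi (weyl_in_form w P) y =
  \sum_(ab <- weyl_supp P | weyl_top P ab)
     iota (P@_ab.2)@_ab.1 * der_act z Phi ab.2 (y - mnm_vec ab.1).
Proof. by rewrite act_sum; apply: eq_bigr => -[a b] _; apply: act_mono. Qed.

(* The lowest-weight part of [P Phi] is the initial form of [P] applied to the
   lowest-weight part [phi] of [Phi]; the second alternative is for [y] of another weight. *)
Lemma act_in_form Phi P y :
  (forall u, Phi u != 0 -> u = 0 \/ 0 < zdeg u) ->
  let phi u := if u == 0 then Phi u else 0 in
  act iota z phi (weyl_in_form w P) y = act iota z Phi P y \/
  act iota z phi (weyl_in_form w P) y = 0.
Proof.
move=> suppPhi phi; rewrite act_in_formE actE.
(* [u ab] is the index at which the monomial [ab] reads [Phi]; its weight is that of [y] plus that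
   of [ab]. A top monomial reading index 0 therefore fixes the weight of [y]. *)
set u := fun ab : 'X_{1..n} * 'X_{1..n} => y - mnm_vec ab.1 + mnm_vec ab.2.
have [/hasP[ab0 sab0 /andP[top0 /eqP u0]]|/hasPn no0] :=
  boolP (has (fun ab => weyl_top P ab && (u ab == 0)) (weyl_supp P)); [left | right].
  have zdegu ab : zdeg (u ab) = weyl_wdeg w ab - weyl_wdeg w ab0.
    have := zdeg_shift y ab0.1 ab0.2; rewrite -/(u ab0) u0 zdeg0 -surjective_pairing.
    move/esym/eqP; rewrite addr_eq0 => /eqP ey.
    by rewrite /u zdeg_shift ey -surjective_pairing addrC.
  (* Monomials that are not top read [Phi] at negative weight, where it vanishes; top ones read it
     at weight 0, where only index 0 contributes. *)
  rewrite [RHS](bigID (weyl_top P)) /= [X in _ + X]big_seq_cond [X in _ + X]big1 ?addr0.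
    rewrite [LHS]big_seq_cond [RHS]big_seq_cond; apply: eq_bigr => ab /andP[sab top].
    congr (_ * (_ * _)); rewrite /phi -/(u ab); case: eqP => // /eqP nz.
    apply/eqP; rewrite eq_sym; apply: contraTT isT => /suppPhi[/eqP|]; first by rewrite (negPf nz).
    rewrite zdegu subr_gt0 ltNge; have /allP -> // := top0.
  move=> ab /andP[sab ntop]; rewrite /der_act -/(u ab); suff -> : Phi (u ab) = 0 by rewrite !mulr0.
  have lt0 : zdeg (u ab) < 0.
    rewrite zdegu subr_lt0 lt_neqAle (allP top0) // andbT.
    apply: contraNneq ntop => eab; apply/allP => ab' sab'.
    by rewrite eab (allP top0).
  apply/eqP; apply: contraTT lt0 => /suppPhi[->|]; first by rewrite zdeg0 ltxx.
  by move/ltW; rewrite -leNgt.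
rewrite big_seq_cond big1 // => ab /andP[sab top].
have := no0 _ sab; rewrite top /= /der_act -/(u ab) /phi => /negPf ->.
by rewrite !mulr0.
Qed.

End InitialForm.

(** * Groebner bases of toric ideals *)

Lemma falling_eq0P (C : fieldType) n (v : 'cV[C]_n) (u : 'X_{1..n}) :
  reflect (exists j (k : nat), (k < u j)%N /\ v j 0 = k%:R) (falling v u == 0).
Proof.
apply: (iffP idP) => [|[j [k [kj vj]]]]; last first.
  rewrite /falling (bigD1 j) //= (bigD1 (Ordinal kj)) //= vj subrr.
  by rewrite !mul0r.
move=> /prodf_eq0 [j _ /prodf_eq0 [k _]].
by rewrite subr_eq0 => /eqP vj; exists j, (k : nat).
Qed.

Lemma falling_dvd (C : fieldType) n (v : 'cV[C]_n) (u u' : 'X_{1..n}) :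
  (u <= u')%MM -> falling v u = 0 -> falling v u' = 0.
Proof.
move=> /mnm_lepP le_uu' /eqP/falling_eq0P[j [k [kj vj]]].
by apply/eqP/falling_eq0P; exists j, k; rewrite (leq_trans kj).
Qed.

Lemma vposB n (u : 'cV[int]_n) : mnm_vec (vpos u) - mnm_vec (vneg u) = u.
Proof.
apply/colP=> j; rewrite !mxE !mnmE mxE oppr_ge0.
by case: (u j 0) => [[|k]|k] //=; rewrite ?subr0 // ?sub0r.
Qed.

Section MonomialIdeals.
Variables (K : fieldType) (n : nat).

Lemma lideal_monomial_msupp (S : 'X_{1..n} -> Prop) (f : {mpoly K[n]}) m :
  lideal (fun q => exists2 m', S m' & q = 'X_[m']) f -> m \in msupp f ->
  exists2 m', S m' & (m' <= m)%MM.
Proof.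
move=> [k [c [s [Ss ->]]]]; rewrite mcoeff_msupp raddf_sum /=.
have [[i ci] _|no] := pselect (exists i, (c i * s i)@_m != 0); last first.
  rewrite big1 ?eqxx // => i _; apply/eqP; apply: contrapT => ci.
  by apply: no; exists i; apply/negP.
move: ci; have [m' Sm' ->] := Ss i; rewrite -mcoeff_msupp.
rewrite (perm_mem (msuppMX _ _)) => /mapP[m'' _ ->]; exists m' => //.
exact: lem_addr.
Qed.

End MonomialIdeals.

Section InitialBinomials.
Variables (K : numFieldType) (n : nat) (R : realDomainType) (w : 'cV[R]_n).
Implicit Types (f : {mpoly K[n]}) (m p q : 'X_{1..n}).

Lemma mcoeff_in_form f m :
  (in_form w f)@_m = f@_m *+ all (fun m' => wdeg w m' <= wdeg w m) (msupp f).
Proof.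
rewrite /in_form raddf_sum /= big_mkcond /=.
under eq_bigr do rewrite mcoeffZ mcoeffX.
have [mf|nmf] := boolP (m \in msupp f); last first.
  rewrite (memN_msupp_eq0 nmf) mul0rn big_seq big1 // => m' m'f.
  case: ifP => // _; case: eqP => [e|]; last by rewrite mulr0.
  by rewrite -e m'f in nmf.
rewrite (bigD1_seq m) ?msupp_uniq //= eqxx mulr1 big1 ?addr0.
  by case: all.
by move=> m' /negPf ->; rewrite mulr0 if_same.
Qed.

Lemma mcoeff_binomial p q m :
  ('X_[p] - 'X_[q] : {mpoly K[n]})@_m = (p == m)%:R - (q == m)%:R.
Proof. by rewrite mcoeffB !mcoeffX. Qed.

Lemma msupp_binomial p q m :
  m \in msupp ('X_[p] - 'X_[q] : {mpoly K[n]}) -> m = p \/ m = q.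
Proof.
rewrite mcoeff_msupp mcoeff_binomial.
have [->|_] := eqVneq p m; first by left.
by have [->|_] := eqVneq q m; [right | rewrite subrr eqxx].
Qed.

Lemma mcoeff_in_form_binomial p q m : p != q -> m = p \/ m = q ->
  wdeg w p <= wdeg w m -> wdeg w q <= wdeg w m ->
  (in_form w ('X_[p] - 'X_[q] : {mpoly K[n]}))@_m = (p == m)%:R - (q == m)%:R.
Proof.
move=> npq mpq wp wq; rewrite mcoeff_in_form mcoeff_binomial.
suff -> : all (fun m' => wdeg w m' <= wdeg w m) (msupp ('X_[p] - 'X_[q] : {mpoly K[n]})) by [].
by apply/allP => m' /msupp_binomial[->|->].
Qed.

(** If [q] were at least as heavy as [p], the initial form would have coefficient -1 at [q], which
    no monomial has in characteristic 0. *)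
Lemma in_form_binomial_monomial p q m :
  in_form w ('X_[p] - 'X_[q] : {mpoly K[n]}) = 'X_[m] -> wdeg w q < wdeg w p /\ m = p.
Proof.
move=> em; have em' k := congr1 (mcoeff k) em.
have npq : p != q.
  apply/eqP=> epq; have := em' m; rewrite mcoeff_in_form epq subrr mcoeff0 mul0rn mcoeffX eqxx.
  by move/esym/eqP; rewrite oner_eq0.
have wqp : wdeg w q < wdeg w p.
  rewrite ltNge; apply/negP=> wpq; have := em' q.
  rewrite mcoeff_in_form_binomial //; last by right.
  rewrite (negPf npq) eqxx sub0r mcoeffX => /eqP.
  by rewrite eqr_oppLR -subr_eq0 opprK -natrD pnatr_eq0.
split=> //; have := em' p; rewrite mcoeff_in_form_binomial ?(ltW wqp) //; last by left.
rewrite eqxx eq_sym (negPf npq) subr0 mcoeffX; case: eqP => // _ /eqP.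
by rewrite oner_eq0.
Qed.

End InitialBinomials.

Section Toric.
Variables (d n : nat) (A : 'M[int]_(d, n)).

(** The form [c] takes the value [e] on every column, so c A u is [e] times the coordinate sum of
    [u]. *)
Lemma homogeneous_lattice (u : 'cV[int]_n) :
  homogeneous_mx A -> in_lattice A u -> \sum_j u j 0 = 0.
Proof.
move=> [c [e [_ e0 ec]]] Au.
suff /eqP : \sum_j (u j 0)%:~R * e = 0 :> rat.
  by rewrite -mulr_suml mulf_eq0 (negPf e0) orbF -rmorph_sum /= intr_eq0 => /eqP.
transitivity (\sum_i c 0 i * ((A *m u) i 0)%:~R); last first.
  by rewrite Au big1 // => i _; rewrite mxE mulr0.
have eqj j : (u j 0)%:~R * e = \sum_i c 0 i * (A i j * u j 0)%:~R.
  rewrite -(ec j) mulr_sumr; apply: eq_bigr => i _.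
  by rewrite intrM mulrCA; congr (_ * _); rewrite mulrC.
rewrite (eq_bigr _ (fun j _ => eqj j)) exchange_big; apply: eq_bigr => i _.
by rewrite mxE rmorph_sum mulr_sumr.
Qed.

Lemma homogeneous_mdeg (p q : 'X_{1..n}) : homogeneous_mx A ->
  A *m mnm_vec p = A *m mnm_vec q -> mdeg p = mdeg q.
Proof.
move=> homA epq.
have Lpq : in_lattice A (mnm_vec p - mnm_vec q) by rewrite /in_lattice mulmxBr epq subrr.
have := homogeneous_lattice homA Lpq.
under eq_bigr do rewrite !mxE.
rewrite sumrB -!(big_morph Posz PoszD (erefl _)) -!mdegE => /eqP.
by rewrite subr_eq0 => /eqP[].
Qed.

(** The functional summing the coefficients of A-degree [t] vanishes on each D^m (D^u - D^u'). On a
    binomial it detects whether both monomials lie in one fiber. *)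
Lemma toric_ideal_degree (K : fieldType) (f : {mpoly K[n]}) (t : 'cV[int]_d) :
  toric_ideal A f -> mlin (fun m c => if A *m mnm_vec m == t then c else 0) f = 0.
Proof.
set G := fun m c => _; have GB m : zmod_morphism (G m).
  by move=> x y; rewrite /G; case: ifP => //; rewrite subrr.
move=> [k [c [s [Ss ->]]]]; rewrite (big_morph _ (mlinD GB) (mlin0 GB)) big1 // => i _.
have [u [u' [euu' ->]]] := Ss i; elim/mpolyind: (c i) => [|e m p _ _ IH].
  by rewrite mul0r mlin0.
rewrite mulrDl mlinD // IH addr0 -scalerAl mulrBr -!mpolyXD scalerBr mlinB // !mlinZX //.
by rewrite /G !mnm_vecD !mulmxDr euu' subrr.
Qed.

Lemma toric_ideal_binomial (K : fieldType) (p q : 'X_{1..n}) :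
  toric_ideal A ('X_[p] - 'X_[q] : {mpoly K[n]}) -> A *m mnm_vec p = A *m mnm_vec q.
Proof.
move=> /(@toric_ideal_degree K _ (A *m mnm_vec p)).
set G := fun m c => _; have GB m : zmod_morphism (G m).
  by move=> x y; rewrite /G; case: ifP => //; rewrite subrr.
rewrite mlinB // -[X in mlin _ X]scale1r mlinZX // -['X_[q]]scale1r mlinZX // /G eqxx.
by case: eqP => // _ /eqP; rewrite subr0 oner_eq0.
Qed.

Lemma binomial_toric (K : fieldType) (p q : 'X_{1..n}) :
  A *m mnm_vec p = A *m mnm_vec q -> toric_ideal A ('X_[p] - 'X_[q] : {mpoly K[n]}).
Proof.
move=> epq; exists 1%N, (fun _ => 1), (fun _ => 'X_[p] - 'X_[q]).
by split; [move=> _; exists p, q | rewrite big_ord1 mul1r].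
Qed.

End Toric.

Section Groebner.
Variables (C : numFieldType) (R : realDomainType) (d n : nat) (A : 'M[int]_(d, n)).
Variables (w : 'cV[R]_n) (M : nat) (g : 'I_M -> 'cV[int]_n).
Hypothesis A_homogeneous : homogeneous_mx A.
Hypothesis g_groebner :
  is_reduced_gb w (toric_ideal (C := C) A) [seq binomial_of C (g i) | i <- enum 'I_M].

Let gb_mem i : binomial_of C (g i) \in [seq binomial_of C (g i) | i <- enum 'I_M].
Proof. by apply: map_f; rewrite mem_enum. Qed.

(** [g_groebner] speaks of binomials; this lemma and [gb_weight] recover the facts about the vectors
    g_i themselves. *)
Lemma gb_lattice i : in_lattice A (g i).
Proof.
have [_ gI _ _ _] := g_groebner; have := toric_ideal_binomial (gI _ (gb_mem i)).
by move=> e; rewrite /in_lattice -(vposB (g i)) mulmxBr e subrr.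
Qed.

Lemma gb_weight i : wdeg w (vneg (g i)) < wdeg w (vpos (g i)).
Proof.
have [_ _ _ gm _] := g_groebner; have [m em] := gm _ (gb_mem i).
by have [] := in_form_binomial_monomial em.
Qed.

Lemma gb_divides f m : in_ideal w (toric_ideal (C := C) A) f -> m \in msupp f ->
  exists i, (vpos (g i) <= m)%MM.
Proof.
have [_ _ gin gm _] := g_groebner; move=> /gin If mf.
suff [m' [i ->] le_m'm] : exists2 m', (exists i, m' = vpos (g i)) & (m' <= m)%MM.
  by exists i.
apply: (@lideal_monomial_msupp C n (fun m' => exists i, m' = vpos (g i)) f) => //.
have [k [c [s [Ss ef]]]] := If; exists k, c, s; split=> // i.
have [h hG ->] := Ss i; have [m' em'] := gm _ hG.
case/mapP: hG em' => j _ -> em'; exists m' => //.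
by exists j; have [] := in_form_binomial_monomial em'.
Qed.

Lemma gb_zdeg i : 0 < zdeg w (g i).
Proof. by rewrite -(vposB (g i)) zdegD zdegN !zdeg_mnm subr_gt0 gb_weight. Qed.

(** Each g_i has positive weight. This supplies the support condition of [act_in_form]. *)
Lemma in_Cw_zdeg u : in_Cw g u -> u = 0 \/ 0 < zdeg w u.
Proof.
case=> c ->; have [/forallP c0|/forallPn[i ci]] := boolP [forall i, c i == 0%N].
  by left; rewrite big1 // => i _; rewrite (eqP (c0 i)) mulr0n.
right; rewrite (big_morph _ (zdegD w) (zdeg0 w)).
have zdegMn j : zdeg w (g j *+ c j) = zdeg w (g j) *+ c j.
  by elim: (c j) => [|k IH]; rewrite ?mulr0n ?zdeg0 // !mulrS zdegD IH.
rewrite (bigD1 i) //= zdegMn ltr_pwDl ?pmulrn_lgt0 ?gb_zdeg ?lt0n //.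
by apply: sumr_ge0 => j _; rewrite zdegMn mulrn_wge0 // ltW // gb_zdeg.
Qed.

Lemma in_Cw0 : in_Cw g 0.
Proof. by exists (fun=> 0%N); rewrite big1. Qed.

Lemma in_CwD i u : in_Cw g u -> in_Cw g (g i + u).
Proof.
case=> c ->; exists (fun j => c j + (j == i))%N.
under [RHS]eq_bigr do rewrite mulrnDr.
rewrite big_split addrC; congr (_ + _); rewrite (bigD1 i) //= eqxx big1 ?addr0 //.
by move=> j /negPf ->.
Qed.

(* Reducing [q] modulo the Groebner basis ends in the unique standard monomial of
   its fiber, which is [p]. *)
Lemma standard_in_Cw p q : (forall i, ~~ (vpos (g i) <= p)%MM) ->
  A *m mnm_vec q = A *m mnm_vec p -> in_Cw g (mnm_vec q - mnm_vec p).
Proof.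
move=> std; pose D := mdeg p.
(* Termination: by homogeneity [q] keeps the degree [D], so finitely many monomials compete, and
   each reduction lowers the number of those lighter than [q]. *)
pose below q := #|[pred m : 'X_{1..n < D.+1} | wdeg w m < wdeg w q]|.
have [k] := ubnP (below q); elim: k q => // k IH q; rewrite ltnS => qk epq.
have [->|npq] := eqVneq q p; first by rewrite subrr; apply: in_Cw0.
have Ipq : in_ideal w (toric_ideal (C := C) A) (in_form w ('X_[q] - 'X_[p])).
  exists 1%N, (fun _ => 1), (fun _ => in_form w ('X_[q] - 'X_[p])).
  split; last by rewrite big_ord1 mul1r.
  by move=> _; exists ('X_[q] - 'X_[p]) => //; apply: binomial_toric.
(* Otherwise [p] would occur in the initial form, hence be divisible by a leading monomial. *)
have wpq : wdeg w p < wdeg w q.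
  rewrite ltNge; apply/negP=> wqp; have [|i] := gb_divides Ipq (m := p).
    rewrite mcoeff_msupp mcoeff_in_form_binomial //; last by right.
    by rewrite (negPf npq) eqxx sub0r oppr_eq0 oner_eq0.
  by apply/negP.
have [|i gq] := gb_divides Ipq (m := q).
  rewrite mcoeff_msupp mcoeff_in_form_binomial ?(ltW wpq) //; last by left.
  by rewrite eqxx [p == q]eq_sym (negPf npq) subr0 oner_eq0.
pose q' := (q - vpos (g i) + vneg (g i))%MM.
have eq' : mnm_vec q = g i + mnm_vec q'.
  rewrite -{1}(submK gq) -[in RHS](vposB (g i)) !mnm_vecD.
  by rewrite addrC -[RHS]addrA; congr (_ + _); rewrite addrCA addNr addr0.
rewrite eq' -addrA; apply: in_CwD.
have epq' : A *m mnm_vec q' = A *m mnm_vec p.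
  by rewrite -epq eq' mulmxDr gb_lattice add0r.
apply: IH => //; apply: leq_trans qk; apply: proper_card.
have wq' : wdeg w q' < wdeg w q.
  by rewrite -[ltRHS]zdeg_mnm eq' zdegD zdeg_mnm ltrDr gb_zdeg.
apply/properP; split; first by apply/subsetP => m; rewrite !inE => /lt_trans; apply.
have q'D : (mdeg q' < D.+1)%N by rewrite ltnS (homogeneous_mdeg A_homogeneous epq').
by exists (BMultinom q'D); rewrite !inE ?ltxx.
Qed.

(** The monomial of u_- is standard: otherwise the fake exponent condition for some g_i gives
    [v]_(u_-) = 0, so some v_j is a natural number below (u_-)_j, and [j] lies in I_u but not in
    I_0. As u_+ and u_- share a fiber, [standard_in_Cw] applies. *)
Lemma in_Cw_nsupp beta (v : 'cV[C]_n) u : is_fake_exponent A beta w v ->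
  in_lattice A u -> nsupp_shift v u = nsupp_shift v 0 -> in_Cw g u.
Proof.
move=> [_ vfake] Lu eu; rewrite -(vposB u); apply: standard_in_Cw => [i|]; last first.
  by apply/eqP; rewrite -subr_eq0 -mulmxBr vposB Lu.
apply/negP=> /falling_dvd /(_ (vfake _ (gb_lattice i) (gb_weight i))) /eqP/falling_eq0P.
case=> j [k []]; rewrite mnmE mxE oppr_ge0; case: ifP => // uj0 kj vj.
have : j \notin nsupp_shift v 0.
  rewrite inE; apply/negP=> /asboolP[l]; rewrite !mxE addr0 vj => /eqP.
  by rewrite -addr_eq0 -natrD pnatr_eq0 addnS.
rewrite -eu inE => /negP; apply; apply/asboolP.
have [N eN] : exists N : nat, u j 0 = - N%:Z.
  by exists (absz (u j 0)); rewrite abszE ler0_norm ?opprK.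
(* With u_j = -N, v_j + u_j = k - N = -((N - k - 1) + 1). *)
rewrite eN opprK absz_nat in kj; exists (N - k.+1)%N.
by rewrite !mxE vj eN subnSK // natrB ?opprB 1?ltnW // mulrNz.
Qed.

Lemma NSw_nsupp0 beta (v : 'cV[C]_n) : is_fake_exponent A beta w v ->
  NSw A g v (nsupp_shift v 0).
Proof.
move=> vfake; exists 0; split=> // [|u Lu eu]; first by rewrite /in_lattice mulmx0.
exact: in_Cw_nsupp vfake Lu eu.
Qed.

End Groebner.

(** * Homogeneous ideals in the local ring at the origin *)

Section LeftIdeals.
Variables (T : nzRingType) (S : T -> Prop).

Lemma lideal0 : lideal S 0.
Proof. by exists 0%N, (fun=> 0), (fun=> 0); split; [case | rewrite big_ord0]. Qed.

Lemma lidealD x y : lideal S x -> lideal S y -> lideal S (x + y).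
Proof.
move=> [k [c [s [Ss ->]]]] [l [c' [s' [Ss' ->]]]].
exists (k + l)%N,
  (fun i => match fintype.split i with inl i => c i | inr i => c' i end),
  (fun i => match fintype.split i with inl i => s i | inr i => s' i end); split.
  by move=> i; case: fintype.split.
by rewrite big_split_ord /=; congr (_ + _); apply: eq_bigr => i _;
  rewrite ?(unsplitK (inl i)) ?(unsplitK (inr i)).
Qed.

Lemma lidealM x y : lideal S y -> lideal S (x * y).
Proof.
move=> [k [c [s [Ss ->]]]]; exists k, (fun i => x * c i), s; split=> //.
by rewrite mulr_sumr; apply: eq_bigr => i _; rewrite mulrA.
Qed.

Lemma lideal_gen x : S x -> lideal S x.
Proof. by move=> Sx; exists 1%N, (fun=> 1), (fun=> x); rewrite big_ord1 mul1r. Qed.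

End LeftIdeals.

Section HomogeneousIdeals.
Variables (C : fieldType) (h : nat).
Implicit Types (f s : {mpoly C[h]}).
Local Notation ishom D f := (f \is D.-homog for (@mdeg h)).
Local Notation piece D f := (pihomog (@mdeg h) D f).

(** Multiplication by [s] shifts the grading by [e]; the test guards the truncated difference D -
    e. *)
Lemma pihomogM_homog D e f s : ishom e s ->
  piece D (f * s) = (if (e <= D)%N then piece (D - e) f else 0) * s.
Proof.
move=> hs; elim/mpolyind: f => [|c m f _ _ IH].
  by case: ifP; rewrite ?pihomog0 !mul0r pihomog0.
rewrite mulrDl pihomogD IH.
have hX : ishom (mdeg m + e) (c *: 'X_[m] * s).
  by rewrite -scalerAl; apply/dhomogZ/dhomogM => //; rewrite dhomogX.
have -> : piece D (c *: 'X_[m] * s) =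
    (if (e <= D)%N then piece (D - e) (c *: 'X_[m]) else 0) * s.
  case: leqP => eD.
    have [eDm|neDm] := eqVneq (D - e)%N (mdeg m).
      rewrite [LHS]pihomog_dE; last by rewrite -(subnK eD) eDm.
      by rewrite pihomog_dE // eDm; apply/dhomogZ; rewrite dhomogX.
    rewrite [LHS](pihomog_ne0 _ hX) ?(@pihomog_ne0 _ _ _ (mdeg m)) ?mul0r //.
    - by rewrite eq_sym.
    - by apply/dhomogZ; rewrite dhomogX.
    - by apply: contra neDm => /eqP <-; rewrite addnK.
  by rewrite [LHS](pihomog_ne0 _ hX) ?mul0r // neq_ltn (leq_trans eD) ?leq_addl ?orbT.
by case: ifP => _; rewrite ?mul0r ?add0r // -mulrDl -pihomogD.
Qed.

Lemma lideal_pihomog (S : {mpoly C[h]} -> Prop) D f :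
  (forall s, S s -> exists e, ishom e s) -> lideal S f -> lideal S (piece D f).
Proof.
move=> homS [k [c [s [Ss ->]]]]; rewrite raddf_sum /=.
elim/big_ind: _ => [|x y|i _]; [exact: lideal0 | exact: lidealD |].
have [e he] := homS _ (Ss i); rewrite (pihomogM_homog _ _ he).
exact/lidealM/lideal_gen.
Qed.

Lemma pihomog0_coef f : piece 0 f = (f@_0%MM)%:MP.
Proof.
elim/mpolyind: f => [|c m f _ _ IH]; first by rewrite pihomog0 mcoeff0 mpolyC0.
rewrite pihomogD IH mcoeffD mpolyCD; congr (_ + _).
rewrite linearZ /= pihomogX mdeg_eq0 mcoeffZ mcoeffX.
by case: eqP => [->|]; rewrite ?mulr1 ?mulr0 ?scaler0 ?mpolyC0 // mpolyX0 -alg_mpolyC.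
Qed.

(* The component of degree [D] of [f * s] is [f(0) * s]. *)
Lemma lideal_homog_cancel (S : {mpoly C[h]} -> Prop) D f s :
  (forall s, S s -> exists e, ishom e s) -> ishom D s -> f@_0%MM != 0 ->
  lideal S (f * s) -> lideal S s.
Proof.
move=> homS hs f0 /(@lideal_pihomog S D _ homS).
rewrite (pihomogM_homog _ _ hs) leqnn subnn pihomog0_coef.
move=> /(lidealM (f@_0%MM)^-1%:MP); rewrite mulrA -mpolyCM mulVf // mpolyC1 mul1r //.
Qed.

End HomogeneousIdeals.

Section Localization.
Variables (C : fieldType) (h : nat) (S : {mpoly C[h]} -> Prop).
Implicit Types (p q : {mpoly C[h]}) (f : {fraction {mpoly C[h]}}).
Local Notation "p %:F" := (@FracField.tofrac _ p).

(* [f] is regular at 0, resp. lies in the extension of the ideal generated by [S]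
   to the local ring of C^h at 0. *)
Definition regular0 f : Prop := exists p q, q@_0%MM != 0 /\ q%:F * f = p%:F.
Definition local_ideal f : Prop :=
  exists p q, [/\ q@_0%MM != 0, lideal S p & q%:F * f = p%:F].

Lemma regular0_tofrac p : regular0 p%:F.
Proof. by exists p, 1; rewrite mcoeff1 eqxx oner_neq0 tofrac1 mul1r. Qed.

Lemma regular0V q : q@_0%MM != 0 -> regular0 q%:F^-1.
Proof.
move=> q0; exists 1, q; split=> //; rewrite mulfV ?tofrac1 //.
by rewrite tofrac_eq0; apply: contraNneq q0 => ->; rewrite mcoeff0.
Qed.

Lemma mcoeff0M p q : (p * q)@_0%MM = p@_0%MM * q@_0%MM.
Proof. exact: rmorphM. Qed.

Lemma regular0M f f' : regular0 f -> regular0 f' -> regular0 (f * f').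
Proof.
move=> [p [q [q0 e]]] [p' [q' [q'0 e']]]; exists (p * p'), (q * q').
by rewrite mcoeff0M mulf_neq0 // !tofracM mulrACA e e'.
Qed.

Lemma regular0_prod (I : Type) (r : seq I) (P : pred I) (f : I -> {fraction {mpoly C[h]}}) :
  (forall i, P i -> regular0 (f i)) -> regular0 (\prod_(i <- r | P i) f i).
Proof.
move=> rf; elim/big_ind: _ => [|x y|//]; last exact: regular0M.
by rewrite -tofrac1; apply: regular0_tofrac.
Qed.

Lemma local_ideal0 : local_ideal 0.
Proof.
exists 0, 1; rewrite mcoeff1 eqxx oner_neq0 mulr0 tofrac0.
by split=> //; apply: lideal0.
Qed.

Lemma local_idealD f f' : local_ideal f -> local_ideal f' -> local_ideal (f + f').
Proof.
move=> [p [q [q0 Ip e]]] [p' [q' [q'0 Ip' e']]]; exists (q' * p + q * p'), (q * q').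
split; first by rewrite mcoeff0M mulf_neq0.
  by apply: lidealD; apply: lidealM.
by rewrite tofracD !tofracM -e -e' mulrDr mulrA [q'%:F * _]mulrC -!mulrA.
Qed.

Lemma local_idealM p f : local_ideal f -> local_ideal (p%:F * f).
Proof.
move=> [p' [q' [q'0 Ip' e']]]; exists (p * p'), q'; split=> //; first exact: lidealM.
by rewrite tofracM -e' mulrCA.
Qed.

Lemma local_ideal_regular p f : lideal S p -> regular0 f -> local_ideal (p%:F * f).
Proof.
move=> Ip [p' [q' [q'0 e']]]; exists (p' * p), q'; split=> //; first exact: lidealM.
by rewrite mulrCA e' tofracM mulrC.
Qed.

(** Clearing the denominator q' leaves q' q p in the ideal, and q' q has a nonzero constant term. *)
Lemma local_ideal_cancel D p q :
  (forall s, S s -> exists e, s \is e.-homog for (@mdeg h)) ->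
  p \is D.-homog for (@mdeg h) -> q@_0%MM != 0 ->
  local_ideal (q%:F * p%:F) -> lideal S p.
Proof.
move=> homS hp q0 [p' [q' [q'0 Ip' e']]].
apply: (@lideal_homog_cancel _ _ S D (q' * q)) => //; first by rewrite mcoeff0M mulf_neq0.
suff -> : q' * q * p = p' by [].
by apply/eqP; rewrite -tofrac_eq -e' -!tofracM mulrA.
Qed.

End Localization.

(** * The series *)

Definition negint (C : numFieldType) (c : C) : bool :=
  `[< exists k : nat, c = - k.+1%:R >].

Lemma negint0 (C : numFieldType) : negint (0 : C) = false.
Proof.
by apply/negP=> /asboolP[k] /eqP; rewrite eq_sym oppr_eq0 pnatr_eq0.
Qed.

Lemma negint_sub1 (C : numFieldType) (c : C) : negint (c - 1) = negint c || (c == 0).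
Proof.
apply/asboolP/orP => [[[|k] /eqP]|[/asboolP[k ->]|/eqP ->]].
- by rewrite subr_eq addNr => ->; right.
- by rewrite subr_eq -addn1 natrD opprD addrNK => /eqP e; left; apply/asboolP; exists k.
- by exists k.+1; rewrite [in RHS]mulrS opprD addrC.
- by exists 0%N; rewrite sub0r.
Qed.

Lemma negint_subn (C : numFieldType) (c : C) (a : nat) : negint c -> negint (c - a%:R).
Proof.
elim: a => [|a IH nc]; first by rewrite subr0.
by rewrite -addn1 natrD opprD addrA negint_sub1 IH.
Qed.

Lemma nsupp_shiftE (C : numFieldType) n (v : 'cV[C]_n) u j :
  (j \in nsupp_shift v u) = negint (v j 0 + (u j 0)%:~R).
Proof. by rewrite inE /negint !mxE. Qed.

(** Here [y] need not lie in L. For two indices y + a and y + a' in L, both supports lie in that of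
    [y], hence so does their union. *)
Lemma nsupp_shift_sub (C : numFieldType) n (v : 'cV[C]_n) y (a : 'X_{1..n}) :
  nsupp_shift v (y + mnm_vec a) \subset nsupp_shift v y.
Proof.
apply/subsetP => j; rewrite !nsupp_shiftE !mxE intrD addrA => /(@negint_subn _ _ (a j)).
by rewrite -pmulrn addrK.
Qed.

(** * Coefficients in one variable *)

Section Coefficients.
Variables (C : numFieldType) (h : nat) (c : C) (l : {mpoly C[h]}).
Hypothesis l0 : l@_0%MM = 0.
Local Notation F := {fraction {mpoly C[h]}}.
Local Notation "p %:F" := (@FracField.tofrac _ p).
Implicit Types k : int.

(* With [t = c + l], the solution of the recurrence [(t + k) e(k) = e(k - 1)], i.e.
   [Gamma (t + 1) / Gamma (t + k + 1)] up to a factor not depending on [k]: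
   [unit_coef] omits the factor [t + k = l] occurring when [c + k = 0] and so is regular
   at 0, while [reg_coef] has it on the side [c + k < 0], hence still no denominator. *)
Definition lin_factor k : {mpoly C[h]} := (c + k%:~R)%:MP + l.

Definition unit_factor k : {mpoly C[h]} :=
  if c + k%:~R == 0 then 1 else lin_factor k.

Definition unit_coef k : F :=
  match k with
  | Posz m => \prod_(i < m) (unit_factor (i.+1%:Z))%:F^-1
  | Negz m => \prod_(i < m.+1) (unit_factor (- i%:Z))%:F
  end.

Definition reg_coef k : F := (if negint (c + k%:~R) then l%:F else 1) * unit_coef k.

Lemma unit_factor0 k : (unit_factor k)@_0%MM != 0.
Proof.
rewrite /unit_factor; case: ifPn => [_|]; first by rewrite mcoeff1 eqxx oner_eq0.
by rewrite mcoeffD mcoeffC eqxx mulr1 l0 addr0.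
Qed.

Lemma unit_coef_regular k : regular0 (unit_coef k).
Proof.
case: k => m; apply: regular0_prod => i _; last exact: regular0_tofrac.
exact/regular0V/unit_factor0.
Qed.

Lemma unit_coefS k : unit_coef (k - 1) = (unit_factor k)%:F * unit_coef k.
Proof.
case: k => [[|m]|m].
- by rewrite sub0r -NegzE /= big_ord1 big_ord0 mulr1 oppr0.
- have -> : m.+1%:Z - 1 = m by rewrite -addn1 PoszD addrK.
  rewrite /= big_ord_recr /= mulrCA mulfV ?mulr1 // tofrac_eq0.
  by apply: contraNneq (unit_factor0 m.+1) => ->; rewrite mcoeff0.
have -> : Negz m - 1 = Negz m.+1 by rewrite !NegzE -opprD -PoszD addn1.
by rewrite /= big_ord_recr /= mulrC NegzE.
Qed.

Lemma unit_coef_rec k : c + k%:~R != 0 ->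
  (lin_factor k)%:F * unit_coef k = unit_coef (k - 1).
Proof. by rewrite unit_coefS /unit_factor => /negPf ->. Qed.

(** Only c + k = 0 differs from [unit_coef_rec]: there k - 1 is the first index on the negative
    side, and the factor [l] that [reg_coef] acquires equals [lin_factor k]. *)
Lemma reg_coef_rec k : (lin_factor k)%:F * reg_coef k = reg_coef (k - 1).
Proof.
rewrite /reg_coef unit_coefS /unit_factor /lin_factor intrD mulrNz addrA negint_sub1.
have [->|_] := eqVneq; last by rewrite orbF mulrCA.
by rewrite negint0 /= mpolyC0 add0r tofrac1 !mul1r.
Qed.

(* On the coordinates in [K] the index [c + k] stays negative, so that the common factor
   [l] can be dropped. *)
Definition kcoef (inK : bool) k : F := if inK then unit_coef k else reg_coef k.

(** The recurrence is iterated [a] times. For [inK] the index stays negative, so the exceptional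
    case c + k = 0 is never met. *)
Lemma kcoef_falling (inK : bool) k (a : nat) : (inK -> negint (c + k%:~R)) ->
  \prod_(i < a) ((lin_factor k)%:F - i%:R) * kcoef inK k = kcoef inK (k - a%:Z).
Proof.
move=> Kneg; elim: a => [|a IH]; first by rewrite big_ord0 mul1r subr0.
rewrite big_ord_recr /= mulrAC IH mulrC -addn1 PoszD opprD addrA.
have -> : (lin_factor k)%:F - a%:R = (lin_factor (k - a%:Z))%:F.
  rewrite /lin_factor intrD mulrNz addrA mpolyCB addrAC tofracB; congr (_ - _).
  by rewrite -pmulrn mpolyC_nat tofracMn tofrac1.
rewrite /kcoef {IH}; case: inK Kneg => [/(_ isT) Kneg|_]; last exact: reg_coef_rec.
apply: unit_coef_rec; rewrite intrD mulrNz addrA.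
apply: contraTneq (negint_subn a Kneg) => e.
by rewrite (_ : _ - a%:R = 0) ?negint0.
Qed.

End Coefficients.

Section Series.
Variables (C : numFieldType) (d n : nat) (A : 'M[int]_(d, n)) (beta : 'cV[C]_d).
Variables (v : 'cV[C]_n) (M : nat) (g : 'I_M -> 'cV[int]_n).
Variables (h : nat) (B : 'M[int]_(n, h)).
Hypothesis v_beta : map_mx intr A *m v = beta.
Hypothesis B_basis : is_lattice_basis A B.
Implicit Types (y u : 'cV[int]_n) (I J : {set 'I_n}).
Local Notation F := {fraction {mpoly C[h]}}.
Local Notation "p %:F" := (@FracField.tofrac _ p).
Local Notation K := (KN A g v B).
Local Notation l := (Bs C B).

Definition iotaF : {rmorphism C -> F} := @FracField.tofrac {mpoly C[h]} \o @mpolyC h C.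

Definition zF (j : 'I_n) : F := (lin_factor (v j 0) (l j) 0)%:F.

(** Defined on all of Z^n, since derivatives of the series are read at indices outside L. *)
Definition coefT y : F := \prod_j kcoef (v j 0) (l j) (j \in K) (y j 0).

Definition series u : F :=
  if `[< in_lattice A u /\ NN A g v B (nsupp_shift v u) >] then coefT u else 0.

(** Named so that [local_ideal genPN] is the extension of P_N to the local ring; [PN] is
    [lideal genPN]. *)
Definition genPN (f : {mpoly C[h]}) : Prop :=
  exists I J, [/\ NN A g v B I, NNc A g v B J & f = Bs_prod C B ((I :|: J) :\: K)].

Lemma Bs_coef0 j : (l j)@_0%MM = 0.
Proof.
rewrite /Bs raddf_sum big1 // => k _.
by rewrite /= mcoeffZ mcoeffX mnm1_eq0 mulr0.
Qed.

Lemma Bs_homog j : l j \is 1.-homog for (@mdeg h).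
Proof.
rewrite /Bs; apply: rpred_sum => k _; apply: dhomogZ.
by rewrite dhomogX /= mdeg1.
Qed.

Lemma Bs_prod_homog J : Bs_prod C B J \is #|J|.-homog for (@mdeg h).
Proof.
rewrite /Bs_prod -sum1_card; elim/big_ind2: _ => [|x1 x2 y1 y2|j _].
- exact: dhomog1.
- exact: dhomogM.
- exact: Bs_homog.
Qed.

Lemma genPN_homog f : genPN f -> exists e, f \is e.-homog for (@mdeg h).
Proof. by move=> [I [J [_ _ ->]]]; exists #|(I :|: J) :\: K|; apply: Bs_prod_homog. Qed.

Lemma lin_factorD (k : int) j : (lin_factor (v j 0) (l j) k)%:F = zF j + k%:~R.
Proof.
rewrite /zF /lin_factor addr0 mpolyCD addrAC tofracD; congr (_ + _).
by rewrite rmorph_int rmorph_int.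
Qed.

Lemma zshiftF y j : zshift zF y j = (lin_factor (v j 0) (l j) (y j 0))%:F.
Proof. by rewrite lin_factorD. Qed.

Lemma KN_sub I : NN A g v B I -> K \subset I.
Proof. by move=> NI; apply: bigcap_inf; apply/asboolP. Qed.

(** Outside K the factor (B s)_j occurs exactly when v_j + y_j is a negative integer; inside K it
    was dropped. The other factor is regular at 0. *)
Lemma coefTE y : coefT y =
  (Bs_prod C B (nsupp_shift v y :\: K))%:F * \prod_j unit_coef (v j 0) (l j) (y j 0).
Proof.
rewrite /Bs_prod rmorph_prod /= (big_mkcond (fun j => j \in _)) -big_split.
apply: eq_bigr => j _; rewrite /kcoef /reg_coef in_setD nsupp_shiftE.
by case: (j \in K); rewrite /= ?mul1r.
Qed.

Lemma coefT_local_ideal y I J : NN A g v B I -> NNc A g v B J ->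
  I \subset nsupp_shift v y -> J \subset nsupp_shift v y -> local_ideal genPN (coefT y).
Proof.
move=> NI NJ sI sJ; rewrite coefTE; apply: local_ideal_regular; last first.
  apply: regular0_prod => j _; apply: unit_coef_regular; exact: Bs_coef0.
rewrite /Bs_prod (big_setID ((I :|: J) :\: K)) /= mulrC.
apply/lidealM/lideal_gen; exists I, J; split=> //.
by rewrite (setIidPr _) // setSD // subUset sI.
Qed.

(** When I_(y + a) is in N it contains K, so [kcoef_falling] applies in every coordinate. The result
    depends on [a] only through the test. *)
Lemma der_series a y : der_act zF series a y =
  if `[< in_lattice A (y + mnm_vec a) /\ NN A g v B (nsupp_shift v (y + mnm_vec a)) >]
  then coefT y else 0.
Proof.
rewrite /der_act /series; case: asboolP => [[_ NI]|_]; last by rewrite mulr0.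
rewrite /ffall /coefT -big_split; apply: eq_bigr => j _ /=.
under eq_bigr do rewrite zshiftF.
rewrite kcoef_falling; [|exact: Bs_coef0|]; last first.
  by move=> /(subsetP (KN_sub NI)); rewrite nsupp_shiftE.
by rewrite !mxE addrK.
Qed.

Lemma supp_mx_lattice u j : in_lattice A u -> j \notin supp_mx B -> u j 0 = 0.
Proof.
move=> Lu; rewrite inE negbK => /eqP Bj0.
have [_ /(_ _ Lu) [c [-> _]]] := B_basis.
rewrite mxE big1 // => k _; have := congr1 (fun r : 'rV_h => r 0 k) Bj0.
by rewrite !mxE => ->; rewrite mul0r.
Qed.

(** [B] spans L, so [u] vanishes off supp(B), where I_u and I_0 thus agree. *)
Lemma supp_mx_nsupp u : in_lattice A u ->
  supp_mx B :|: nsupp_shift v u = supp_mx B :|: nsupp_shift v 0.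
Proof.
move=> Lu; apply/setP=> j; rewrite !in_setU !nsupp_shiftE mxE.
by have [//|/(supp_mx_lattice Lu) ->] := boolP (j \in supp_mx B).
Qed.

Lemma NN_or_NNc u : in_lattice A u -> ~ NN A g v B (nsupp_shift v u) ->
  NNc A g v B (nsupp_shift v u).
Proof. by move=> Lu nN; split=> //; exists u; split=> //; apply: supp_mx_nsupp. Qed.

(** The indices y + a and y + a' lie in L together, and both derivatives have coefficient [coefT y]
    or 0. They can differ only if one support is in N and the other in N^c; both lie in that of [y],
    so [coefT y] is in the ideal. *)
Lemma series_toric a a' : A *m mnm_vec a = A *m mnm_vec a' ->
  forall y, local_ideal genPN (der_act zF series a y - der_act zF series a' y).
Proof.
have LN f : local_ideal genPN f -> local_ideal genPN (- f).
  by move=> /(local_idealM (- 1)); rewrite tofracN tofrac1 mulN1r.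
move=> eaa' y; rewrite !der_series.
have Laa' : in_lattice A (y + mnm_vec a) <-> in_lattice A (y + mnm_vec a').
  by rewrite /in_lattice !mulmxDr eaa'.
case: asboolP => [[La Na]|na]; case: asboolP => [[La' Na']|na'].
- by rewrite subrr; apply: local_ideal0.
- rewrite subr0; apply: (coefT_local_ideal Na (NN_or_NNc (Laa'.1 La) _)); last 2 first.
  + exact: nsupp_shift_sub.
  + exact: nsupp_shift_sub.
  by move=> Na'; apply: na'; split=> //; apply: Laa'.1.
- rewrite sub0r; apply: LN; apply: (coefT_local_ideal Na' (NN_or_NNc (Laa'.2 La') _)); last 2 first.
  + exact: nsupp_shift_sub.
  + exact: nsupp_shift_sub.
  by move=> Na; apply: na; split=> //; apply: Laa'.2.
- by rewrite subrr; apply: local_ideal0.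
Qed.

(** On the support of the series A (v + B s + y) = beta, because A v = beta, A B = 0 and A y = 0. *)
Lemma series_euler i y :
  (\sum_j zshift zF y j *~ A i j - iotaF (beta i 0)) * series y = 0.
Proof.
rewrite /series; case: asboolP => [[Ly _]|]; last by rewrite mulr0.
suff -> : \sum_j zshift zF y j *~ A i j = iotaF (beta i 0) by rewrite subrr mul0r.
under eq_bigr do rewrite zshiftF -rmorphMz.
rewrite -rmorph_sum; congr (_%:F); rewrite /lin_factor.
under eq_bigr do rewrite mulrzDl.
rewrite big_split /=.
have -> : \sum_j l j *~ A i j = 0.
  apply/mpolyP => m; rewrite raddf_sum mcoeff0.
  have [Bcol _] := B_basis.
  transitivity (\sum_k (col k ((A *m B) : 'M_(d, h)) i 0)%:~R * ('X_k : {mpoly C[h]})@_m).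
    rewrite (eq_bigr (fun j => \sum_k (A i j * B j k)%:~R * ('X_k : {mpoly C[h]})@_m)) => [|j _].
      rewrite exchange_big; apply: eq_bigr => k _.
      by rewrite -mulr_suml !mxE rmorph_sum.
    rewrite raddfMz /= /Bs raddf_sum /= -mulrzl mulr_sumr; apply: eq_bigr => k _.
    by rewrite mcoeffZ mulrA intrM.
  by rewrite big1 // => k _; rewrite colE -mulmxA -colE Bcol mxE mul0r.
rewrite addr0 -v_beta mxE.
transitivity ((\sum_j (v j 0 + (y j 0)%:~R) *~ A i j)%:MP_[h]).
  by rewrite raddf_sum; apply: eq_bigr => j _; rewrite /= raddfMz.
congr (_%:MP).
have := congr1 (fun t : 'cV_d => (t i 0)%:~R : C) Ly; rewrite !mxE rmorph_sum /= => Ayi.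
transitivity (\sum_j map_mx intr A i j * v j 0 + \sum_j (A i j * y j 0)%:~R); last first.
  by rewrite Ayi addr0.
rewrite -big_split; apply: eq_bigr => j _.
by rewrite mxE mulrzDl intrM !mulrzl.
Qed.

End Series.

(** * The leading term and the indicial ideal *)

Lemma act_coef_op (n : nat) (C : fieldType) (F : comNzRingType) (iota : {rmorphism C -> F})
    (z : 'I_n -> F) (Phi : 'cV[int]_n -> F) (f : {mpoly C[n]}) (Q : weyl C n) y :
  act iota z Phi (@coef_op n (polyDiffRing C n) f * Q) y =
  \sum_(a <- msupp f) iota f@_a * act iota z Phi Q (y - mnm_vec a).
Proof.
rewrite coef_op_mul [X in X *: _]mpolyE scaler_suml act_sum.
by apply: eq_bigr => a _; apply: actZ.
Qed.

Section Exponent.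
Variables (C : numFieldType) (R : realDomainType) (d n : nat) (A : 'M[int]_(d, n)).
Hypothesis A_homogeneous : homogeneous_mx A.
Variables (beta : 'cV[C]_d) (w : 'cV[R]_n) (v : 'cV[C]_n).
Hypothesis v_fake : is_fake_exponent A beta w v.
Variables (M : nat) (g : 'I_M -> 'cV[int]_n).
Hypothesis g_groebner :
  is_reduced_gb w (toric_ideal (C := C) A) [seq binomial_of C (g i) | i <- enum 'I_M].
Variables (h : nat) (B : 'M[int]_(n, h)).
Hypothesis B_basis : is_lattice_basis A B.

Local Notation iota := (iotaF C h).
Local Notation z := (zF v B).
Local Notation Phi := (series A v g B).
Local Notation Z := (local_ideal (genPN A v g B)).
Local Notation "p %:F" := (@FracField.tofrac _ p).

Lemma local_ideal_zshift y i f : Z f -> Z ((zshift z y i + 1) * f).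
Proof. by move=> Zf; rewrite zshiftF -tofrac1 -tofracD; apply: local_idealM. Qed.

Lemma local_ideal_iota c f : Z f -> Z (iota c * f).
Proof. exact: local_idealM. Qed.

Lemma act_local_ideal (Psi : 'cV[int]_n -> {fraction {mpoly C[h]}}) (S : weyl C n -> Prop) :
  (forall P, S P -> forall y, Z (act iota z Psi P y)) ->
  forall P, lideal S P -> forall y, Z (act iota z Psi P y).
Proof.
apply: act_lideal; [exact: local_ideal0 | exact: local_idealD |
  exact: local_ideal_iota | exact: local_ideal_zshift].
Qed.

Lemma hypergeometric_series P :
  hypergeometric_ideal A beta P -> forall y, Z (act iota z Phi P y).
Proof.
apply: act_local_ideal => {}P [[f If ->]|[i ->]] y.
  apply: (act_toric (A := A)) If y; [exact: local_ideal0 | exact: local_idealD |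
    exact: local_ideal_iota | exact: series_toric].
rewrite act_euler series_euler //; [exact: local_ideal0 | exact: v_fake.1].
Qed.

Lemma series_supp u : Phi u != 0 -> u = 0 \/ 0 < zdeg w u.
Proof.
rewrite /series; case: asboolP => [[Lu [[u' [Lu' e Cw]] _]] _|]; last by rewrite eqxx.
by apply: (in_Cw_zdeg g_groebner); apply: Cw.
Qed.

(** I_0 belongs to N by [NSw_nsupp0], and at index 0 the products in [unit_coef] are empty. *)
Lemma series0 : Phi 0 = (mN A g v B)%:F.
Proof.
rewrite /series asboolT; last first.
  split; first by rewrite /in_lattice mulmx0.
  by split=> //; apply: NSw_nsupp0 A_homogeneous g_groebner _ _ v_fake.
rewrite coefTE [X in _ * X]big1 ?mulr1 // => j _.
by rewrite mxE /= big_ord0.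
Qed.

Definition leading_series u := if u == 0 then Phi u else 0.

Lemma leading_series_annihilated P : weyl_in_ideal w (hypergeometric_ideal A beta) P ->
  forall y, Z (act iota z leading_series P y).
Proof.
apply: act_local_ideal => {}P [Q HQ ->] y.
have [->|->] := act_in_form iota z Q y series_supp; last exact: local_ideal0.
exact: hypergeometric_series.
Qed.

(** This is p(z) as a polynomial in s; the entry of the zero vector is kept to match
    [zshift z 0]. *)
Definition theta_value (p : {mpoly C[n]}) : {mpoly C[h]} :=
  mmap (@mpolyC h C) (fun j => lin_factor (v j 0) (Bs C B j) ((0 : 'cV[int]_n) j 0)) p.

Lemma theta_valueE p : mmap iota (zshift z 0) p = (theta_value p)%:F.
Proof.
rewrite /theta_value /mmap rmorph_sum; apply: eq_bigr => m _.
rewrite rmorphM; congr (_ * _); rewrite rmorph_prod; apply: eq_bigr => j _.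
by rewrite rmorphXn zshiftF.
Qed.

Lemma theta_value0 p : (theta_value p)@_0%MM = p.@[fun j => v j 0].
Proof.
rewrite /theta_value mevalE /mmap raddf_sum; apply: eq_bigr => m _.
rewrite /= mcoeff0M mpolyCK; congr (_ * _); rewrite rmorph_prod; apply: eq_bigr => j _.
by rewrite rmorphXn /= mcoeffD mpolyCK Bs_coef0 addr0 mxE addr0.
Qed.

Lemma exponent_of_mN : ~ PN A g v B (mN A g v B) ->
  is_exponent w (hypergeometric_ideal A beta) v.
Proof.
move=> mP p ind_p.
pose T P := forall y, Z (act iota z leading_series P y).
have [f f0 Tf] : exists2 f : {mpoly C[n]}, f != 0 &
    T (@coef_op n (polyDiffRing C n) f * mmap (@weylC C n) (@theta C n) p).
  apply: (ind_ideal_clear (T := T)) ind_p => [y|P Q TP TQ y|P Q TQ|P].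
  - by rewrite act0; apply: local_ideal0.
  - by rewrite actD; apply: local_idealD.
  - by apply: (@act_local_ideal _ T) => //; apply/lidealM/lideal_gen.
  - exact: leading_series_annihilated.
(* If p(v) != 0, then p(z) has a nonzero constant term and can be cancelled from p(z) m(s). *)
apply/eqP; apply: contrapT => /negP pv0; apply: mP.
(* A monomial x^a of [f] is singled out: the leading series sits at index 0, so at index [a] only
   x^a contributes, with value f_a p(z) m(s). *)
have [a fa] : exists a, f@_a != 0 by exists (mlead f); rewrite mleadc_eq0.
apply: (@local_ideal_cancel C h (genPN A v g B) _ _ (theta_value p)) => //.
- exact: genPN_homog.
- exact: Bs_prod_homog.
- by rewrite theta_value0.
have := Tf (mnm_vec a); rewrite act_coef_op (bigD1_seq a) ?msupp_uniq ?mcoeff_msupp //=.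
rewrite big1 ?addr0 => [|b /negPf ba]; last first.
  rewrite act_theta_poly /leading_series subr_eq0.
  case: eqP => [/colP eab|]; last by rewrite !mulr0.
  suff eba : b = a by rewrite eba eqxx in ba.
  by apply/mnmP => j; have := eab j; rewrite !mxE => -[].
rewrite act_theta_poly subrr theta_valueE /leading_series eqxx series0.
by move=> /(local_ideal_iota (f@_a)^-1); rewrite mulrA -rmorphM mulVf // rmorph1 mul1r.
Qed.

End Exponent.

Theorem proposition4p1 (R : realType) (d n : nat) (A : 'M[int]_(d, n))
    (A_rank : \rank (map_mx intr A : 'M[rat]_(d, n)) = d)
    (A_homogeneous : homogeneous_mx A)
    (beta : 'cV[R[i]]_d) (w : 'cV[R]_n)
    (w_generic_toric : is_monomial_ideal (in_ideal w (toric_ideal (C := R[i]) A)))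
    (w_generic_hyper : generic_weight (hypergeometric_ideal A beta) w)
    (v : 'cV[R[i]]_n) (v_fake : is_fake_exponent A beta w v)
    (M : nat) (g : 'I_M -> 'cV[int]_n)
    (g_groebner : is_reduced_gb w (toric_ideal (C := R[i]) A)
                    [seq binomial_of R[i] (g i) | i <- enum 'I_M])
    (g_initial : forall i,
       in_ideal w (toric_ideal (C := R[i]) A) 'X_[vpos (g i)])
    (h : nat) (B : 'M[int]_(n, h)) (B_basis : is_lattice_basis A B) :
  ~ PN A g v B (mN A g v B) -> is_exponent w (hypergeometric_ideal A beta) v.
Proof.
exact: (exponent_of_mN A_homogeneous v_fake g_groebner B_basis).
Qed.
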